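(* Assume condition (ND) holds and let $x\in(0,1)\setminus D$. Then $$\lim_{h\to0,\,h>0}\frac{\Delta_1F(x,x+h)}{\log_2(1/h)}\ \text{ exists as a real number}$$ if and only if $$\lim_{n\to\infty}\frac{m_{n+1}(1-x)}{m_n(1-x)}=1\quad\text{and}\quad\lim_{n\to\infty}\frac{Z_{1,n}(x)}{n}\ \text{ exists}.$$ If these hold, then $$\lim_{h\to0,\,h>0}\frac{\Delta_1F(x,x+h)}{\log_2(1/h)}=\lim_{n\to\infty}\frac{Z_{1,n}(x)}{n}.$$
   Context: Setting. Let $E\subset\mathbb{R}^3$ be the set of $(b,u,v)$ with $0<b<1$, $b-1<u<\frac1b-1$, $-b<v<\frac{b}{1-b}$, and such that $(1+v)(1-b(1+u))^2<1-b$ or $(b+v)^2<b(1+u)(1+v)^2$. Fix an open interval $I\ni 0$ and a smooth ($C^\infty$) curve $t\mapsto(b_1(t),c_0(t),c_1(t))\in E$, $t\in I$; write $b_1,c_0,c_1$ for the values at $t=0$. For $A=\begin{pmatrix}a&b\\c&d\end{pmatrix}$ put $\Phi(A;z)=\frac{az+b}{cz+d}$, and let $$A_0(t)=\begin{pmatrix}b_1(t)(1+c_0(t))&0\\c_0(t)&1\end{pmatrix},\quad A_1(t)=\begin{pmatrix}1-b_1(t)+c_1(t)&b_1(t)\\c_1(t)&1\end{pmatrix}.$$ For $t\in I$, $F(t,\cdot)$ is the unique continuous $f:[0,1]\to[0,1]$ with $f(x)=\Phi(A_0(t);f(2x))$ for $0\le x\le\frac12$ and $f(x)=\Phi(A_1(t);f(2x-1))$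 for $\frac12\le x\le1$; it is strictly increasing with $F(t,0)=0$, $F(t,1)=1$. Write $F(x)=F(0,x)$, $f_1(x)=\partial_tF(0,x)$ (exists, continuous in $x$), $\Delta_1F(x,y)=\frac{f_1(x)-f_1(y)}{F(x)-F(y)}$ for $x\ne y$. $D=\bigcup_{n\ge1}\{k/2^n:1\le k\le2^n-1\}$. For $x\in[0,1)$, $X_i(x)$ is the $i$-th binary digit of $x$ (expansion with finitely many $1$'s for dyadic rationals), $x_n=\sum_{i=1}^nX_i(x)2^{-i}$, $Z_{1,n}(x)=\Delta_1F(x_n,x_n+2^{-n})$, and $m_1(z)<m_2(z)<\cdots$ are the elements of $\{i\ge1:X_i(z)=1\}$ in increasing order. Condition (ND). Put $G_0(t,y)=b_1(t)(1+c_0(t))y+c_0(t)$, $G_1(t,y)=\frac{(1-b_1(t)+c_1(t))y+c_1(t)}{b_1(t)y+1}$, $\alpha=\min\{0,\frac{c_0}{1-b_1(1+c_0)},\frac{c_1}{b_1}\}$, $\beta=\max\{0,\frac{c_0}{1-b_1(1+c_0)},\frac{c_1}{b_1}\}$. The dual curve is $(\widetilde b_1,\widetilde c_0,\widetilde c_1)(t)=\left(1-b_1(t),-\frac{c_1(t)}{1+c_1(t)},-\frac{c_0(t)}{1+c_0(t)}\right)$, and $\widetilde G_i,\widetilde\alpha,\widetilde\beta$ are defined from it by the same formulas. Let $\delta_i=\min_{y\in[\alpha,\beta]}\frac{\partial_tG_i(0,y)}{1-\partial_yG_i(0,y)}$, $\widetilde\delta_i=\max_{y\in[\widetilde\alpha,\widetilde\beta]}\frac{\partial_t\widetilde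 G_i(0,y)}{1-\partial_y\widetilde G_i(0,y)}$, $i=0,1$ ($\delta_1$ is considered defined only if $\partial_yG_1(0,\cdot)<1$ on $[\alpha,\beta]$, $\widetilde\delta_1$ only if $\partial_y\widetilde G_1(0,\cdot)<1$ on $[\widetilde\alpha,\widetilde\beta]$; at least one is defined). (ND) means: either $\delta_1$ is defined and $b_1'(0)(\alpha+1)+b_1(1-b_1)\min\{0,\delta_0,\delta_1\}>0$, or $\widetilde\delta_1$ is defined and $\widetilde b_1'(0)(\widetilde\alpha+1)+\widetilde b_1(0)(1-\widetilde b_1(0))\max\{0,\widetilde\delta_0,\widetilde\delta_1\}<0$. *)

(* Defs.v *)
From Stdlib Require Import Reals ZArith.
From Coquelicot Require Import Coquelicot.
Open Scope R_scope.

Definition in_E (b u v : R) : Prop :=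
  0 < b < 1 /\ b - 1 < u < 1 / b - 1 /\ - b < v < b / (1 - b) /\
  ((1 + v) * (1 - b * (1 + u)) ^ 2 < 1 - b \/
   (b + v) ^ 2 < b * (1 + u) * (1 + v) ^ 2).

(* The functions are total; only their values on the parameter interval matter. *)
Record curve := Curve { b1 : R -> R; c0 : R -> R; c1 : R -> R }.

(* Endpoints are in [Rbar], so that the interval may be unbounded. *)
Definition open_itv (p q : Rbar) (t : R) : Prop := Rbar_lt p t /\ Rbar_lt t q.

Definition smooth_on (I : R -> Prop) (f : R -> R) : Prop :=
  forall (n : nat) (t : R), I t -> ex_derive_n f n t.

Definition smooth_curve_in_E (I : R -> Prop) (g : curve) : Prop :=
  smooth_on I (b1 g) /\ smooth_on I (c0 g) /\ smooth_on I (c1 g) /\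
  (forall t, I t -> in_E (b1 g t) (c0 g t) (c1 g t)).

Record mat2 := Mat2 { ma : R; mb : R; mc : R; md : R }.

Definition Phi (A : mat2) (z : R) : R := (ma A * z + mb A) / (mc A * z + md A).

Definition A0 (g : curve) (t : R) : mat2 :=
  Mat2 (b1 g t * (1 + c0 g t)) 0
       (c0 g t)                1.

Definition A1 (g : curve) (t : R) : mat2 :=
  Mat2 (1 - b1 g t + c1 g t) (b1 g t)
       (c1 g t)              1.

(* f solves the de Rham functional equations at parameter t; for a curve in E
   this determines f on [0,1], and its values elsewhere are irrelevant. *)
Definition de_Rham_solution (g : curve) (t : R) (f : R -> R) : Prop :=
  continuous_on (fun x => 0 <= x <= 1) f /\
  (forall x, 0 <= x <= 1 -> 0 <= f x <= 1) /\
  (forall x, 0 <= x <= 1 / 2 -> f x = Phi (A0 g t) (f (2 * x))) /\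
  (forall x, 1 / 2 <= x <= 1 -> f x = Phi (A1 g t) (f (2 * x - 1))).

Definition f1 (F : R -> R -> R) (x : R) : R := Derive (fun t => F t x) 0.

Definition Delta1F (F : R -> R -> R) (x y : R) : R :=
  (f1 F x - f1 F y) / (F 0 x - F 0 y).

Definition dyadic (x : R) : Prop :=
  exists n k : nat,
    (1 <= n)%nat /\ (1 <= k <= 2 ^ n - 1)%nat /\ x = INR k / 2 ^ n.

(* For i >= 1 and 0 <= x < 1 this is the i-th binary digit of x; taking the
   floor selects, for dyadic x, the expansion with finitely many ones. *)
Definition digit (i : nat) (x : R) : Z := (Zfloor (2 ^ i * x) mod 2)%Z.

Definition trunc (n : nat) (x : R) : R :=
  sum_n_m (fun i => IZR (digit i x) / 2 ^ i) 1 n.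

Definition Z1 (F : R -> R -> R) (n : nat) (x : R) : R :=
  Delta1F F (trunc n x) (trunc n x + / 2 ^ n).

(* m 1 < m 2 < ... are the positions i >= 1 of the digits 1 of z, infinitely
   many of them; the value m 0 is irrelevant. *)
Definition enumerates_ones (z : R) (m : nat -> nat) : Prop :=
  (forall n, (1 <= n)%nat -> (m n < m (S n))%nat) /\
  (forall i, ((1 <= i)%nat /\ digit i z = 1%Z) <->
             exists n, (1 <= n)%nat /\ m n = i).

Definition log2 (y : R) : R := ln y / ln 2.

Definition G0 (g : curve) (t y : R) : R :=
  b1 g t * (1 + c0 g t) * y + c0 g t.

Definition G1 (g : curve) (t y : R) : R :=
  ((1 - b1 g t + c1 g t) * y + c1 g t) / (b1 g t * y + 1).

Definition alpha (g : curve) : R :=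
  Rmin 0 (Rmin (c0 g 0 / (1 - b1 g 0 * (1 + c0 g 0))) (c1 g 0 / b1 g 0)).

Definition beta (g : curve) : R :=
  Rmax 0 (Rmax (c0 g 0 / (1 - b1 g 0 * (1 + c0 g 0))) (c1 g 0 / b1 g 0)).

Definition dual (g : curve) : curve :=
  Curve (fun t => 1 - b1 g t)
        (fun t => - (c1 g t / (1 + c1 g t)))
        (fun t => - (c0 g t / (1 + c0 g t))).

Definition is_min_on (a b : R) (f : R -> R) (m : R) : Prop :=
  (exists y, a <= y <= b /\ f y = m) /\ (forall y, a <= y <= b -> m <= f y).

Definition is_max_on (a b : R) (f : R -> R) (m : R) : Prop :=
  (exists y, a <= y <= b /\ f y = m) /\ (forall y, a <= y <= b -> f y <= m).

(* The quotient d_t G (0,y) / (1 - d_y G (0,y)). *)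
Definition drift (G : R -> R -> R) (y : R) : R :=
  Derive (fun t => G t y) 0 / (1 - Derive (fun z => G 0 z) y).

Definition slope_lt_1 (g : curve) : Prop :=
  forall y, alpha g <= y <= beta g -> Derive (fun z => G1 g 0 z) y < 1.

Definition ND_min (g : curve) : Prop :=
  slope_lt_1 g /\
  exists d0 d1 : R,
    is_min_on (alpha g) (beta g) (drift (G0 g)) d0 /\
    is_min_on (alpha g) (beta g) (drift (G1 g)) d1 /\
    Derive (b1 g) 0 * (alpha g + 1)
      + b1 g 0 * (1 - b1 g 0) * Rmin 0 (Rmin d0 d1) > 0.

Definition ND_max (g : curve) : Prop :=
  slope_lt_1 g /\
  exists d0 d1 : R,
    is_max_on (alpha g) (beta g) (drift (G0 g)) d0 /\
    is_max_on (alpha g) (beta g) (drift (G1 g)) d1 /\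
    Derive (b1 g) 0 * (alpha g + 1)
      + b1 g 0 * (1 - b1 g 0) * Rmax 0 (Rmax d0 d1) < 0.

Definition ND (g : curve) : Prop := ND_min g \/ ND_max (dual g).

(* Main.v *)
Require Import Defs.
From Stdlib Require Import Reals ZArith List Lra Lia.
From Coquelicot Require Import Coquelicot.
(* Imported again because Stdlib's [Reals] has its own [c1]. *)
Require Import Defs.
Open Scope R_scope.

(** The increasing function F(t,.) splits the mass of each dyadic interval at the
    midpoint in a ratio o : 1 that evolves as follows: o = b/(1-b) for
    [0,1], o' = a0 (1+o) for the left half and o' = a1 o/(1+o) for the right half,
    where a0 = b(1+c0) < 1 < a1 = (1+c1)/(1-b).  Hence p = o/(1+o) stays away from
    0 and 1, and the logarithmic t-derivative kap of o is bounded.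
    The logarithmic derivative Z of the mass of an interval changes by (1-p) kap
    for a digit 0 and by -p kap for a digit 1, and Delta_1 F is an average of Z
    weighted by mass.  Condition (ND) says that kap is bounded below by a positive
    constant, so that Z grows along digits 0 and drops along digits 1.

    Let n be the position of a digit 0 of x that is followed by e digits 1.  For
    x+h in the sibling of the interval of x of level n, Delta_1 F(x,x+h) differs from
    Z_n by O(1+e), and log2(1/h) lies between n and n+e, up to a constant.  This
    gives sufficiency.  For necessity, a limit L is tested at the midpoint x+h_0
    between the siblings and at points x+h_0+2^-(n+j) with j a small multiple of e.
    The latter give averages of at least Z_n + const*j, so that e = o(n) if L is
    small; the former give a drop of Z by const*e, so that e = o(n) if L > 0. *)

(** * The odds and their logarithmic derivatives *)

(** One number per word suffices because the Möbius maps of [0,1] fixing 0 and 1 form a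
    one-parameter group: rescaled to [0,1], F on the interval of a word is [psi v] applied to F,
    where v = [rel_odds]. Differentiating this in t, the mass contributes [lder] times F, and
    [psi v] contributes an error that is bounded over all words.

    The obstacle is that f1 differentiates a function known only through a functional equation in x.
    It is obtained as a limit of derivatives at dyadic points, and for this limit the bounds on
    [odds] and [kap] must hold uniformly over all words and all t near 0, not only at t = 0.

    How (ND) bounds [kap]: y = v - 1 evolves by G0 and G1, so its t-derivative obeys an affine
    recursion, and the quotients in (ND) are the fixed points of this recursion at frozen y. Their
    minimum, capped by the initial value 0, bounds the t-derivative of y from below. Since [kap] of
    a word is [kap] of the empty word plus that derivative over v, positivity follows. The second
    alternative is the same statement for 1 - F(t,1-x), whose [kap] has the opposite sign. *)

Definition core (b u v : R) : Prop :=
  0 < b < 1 /\ b - 1 < u < 1 / b - 1 /\ - b < v < b / (1 - b).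

Definition regular (g : curve) (t : R) : Prop :=
  core (b1 g t) (c0 g t) (c1 g t) /\
  ex_derive (b1 g) t /\ ex_derive (c0 g) t /\ ex_derive (c1 g) t.

(** The coefficients a0 and a1 of the overview, followed by their logarithmic t-derivatives. *)
Definition factor0 (g : curve) (t : R) : R := b1 g t * (1 + c0 g t).
Definition factor1 (g : curve) (t : R) : R := (1 + c1 g t) / (1 - b1 g t).
Definition ldfactor0 (g : curve) (t : R) : R :=
  Derive (b1 g) t / b1 g t + Derive (c0 g) t / (1 + c0 g t).
Definition ldfactor1 (g : curve) (t : R) : R :=
  Derive (c1 g) t / (1 + c1 g t) + Derive (b1 g) t / (1 - b1 g t).

(* A word lists binary digits with the most recent one first; it denotes the
   dyadic interval of length 2^-|w| starting at [left w].  The image of this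
   interval under F is split by F at its midpoint in the ratio [odds g w t]. *)
Fixpoint odds (g : curve) (w : list bool) (t : R) : R :=
  match w with
  | nil => b1 g t / (1 - b1 g t)
  | false :: w' => factor0 g t * (1 + odds g w' t)
  | true :: w' => factor1 g t * (odds g w' t / (1 + odds g w' t))
  end.

(** The share of the mass that goes to the left half. *)
Definition prob (g : curve) (w : list bool) (t : R) : R :=
  odds g w t / (1 + odds g w t).

(** The logarithmic t-derivative of [odds]: that of 1 + o is p times that of o, and that of o / (1 +
    o) is 1 - p times that of o. *)
Fixpoint kap (g : curve) (w : list bool) (t : R) : R :=
  match w with
  | nil => Derive (b1 g) t / (b1 g t * (1 - b1 g t))
  | false :: w' => ldfactor0 g t + prob g w' t * kap g w' t
  | true :: w' => ldfactor1 g t + (1 - prob g w' t) * kap g w' t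
  end.

(** The increment of F over the interval of [w]; [lder] below is its logarithmic t-derivative. *)
Fixpoint mass (g : curve) (w : list bool) (t : R) : R :=
  match w with
  | nil => 1
  | false :: w' => mass g w' t * prob g w' t
  | true :: w' => mass g w' t * (1 - prob g w' t)
  end.

Fixpoint lder (g : curve) (w : list bool) (t : R) : R :=
  match w with
  | nil => 0
  | false :: w' => lder g w' t + (1 - prob g w' t) * kap g w' t
  | true :: w' => lder g w' t - prob g w' t * kap g w' t
  end.

(** The value of F at the left end of the interval, with t-derivative [dlow]: a digit 1 skips the
    mass of the left half. *)
Fixpoint low (g : curve) (w : list bool) (t : R) : R :=
  match w with
  | nil => 0
  | false :: w' => low g w' t
  | true :: w' => low g w' t + mass g (false :: w') t
  end.

Fixpoint dlow (g : curve) (w : list bool) (t : R) : R :=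
  match w with
  | nil => 0
  | false :: w' => dlow g w' t
  | true :: w' => dlow g w' t + lder g (false :: w') t * mass g (false :: w') t
  end.

Lemma core_factors (b u v : R) : core b u v ->
  0 < b < 1 /\ 0 < 1 + u /\ 0 < 1 + v /\ b * (1 + u) < 1 /\ 1 < (1 + v) / (1 - b)
  /\ v * (1 - b) < b.
Proof.
intros [Hb [[Hu1 Hu2] [Hv1 Hv2]]].
assert (b * (1 + u) < 1).
{ rewrite Rmult_comm; apply (Rlt_div_r (1 + u)); lra. }
assert (v * (1 - b) < b).
{ apply Rlt_div_r; lra. }
repeat split; try lra.
apply Rlt_div_r; lra.
Qed.

Lemma odds_pos (g : curve) (w : list bool) (t : R) :
  core (b1 g t) (c0 g t) (c1 g t) -> 0 < odds g w t.
Proof.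
intros H; destruct (core_factors _ _ _ H) as (Hb & Hu & Hv & _).
induction w as [|[|] w IH]; simpl; unfold factor0, factor1.
- apply Rdiv_lt_0_compat; lra.
- apply Rmult_lt_0_compat; apply Rdiv_lt_0_compat; lra.
- repeat apply Rmult_lt_0_compat; lra.
Qed.

Lemma prob_bounds (g : curve) (w : list bool) (t : R) :
  core (b1 g t) (c0 g t) (c1 g t) -> 0 < prob g w t < 1.
Proof.
intros H; pose proof (odds_pos g w t H) as Ho; unfold prob.
split; [apply Rdiv_lt_0_compat; lra|].
apply Rlt_div_l; lra.
Qed.

Lemma mass_pos (g : curve) (w : list bool) (t : R) :
  core (b1 g t) (c0 g t) (c1 g t) -> 0 < mass g w t.
Proof.
intros H; induction w as [|[|] w IH]; simpl; [lra| |];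
  pose proof (prob_bounds g w t H); apply Rmult_lt_0_compat; lra.
Qed.

Lemma mass_split (g : curve) (w : list bool) (t : R) :
  mass g (false :: w) t + mass g (true :: w) t = mass g w t.
Proof. simpl; ring. Qed.

Lemma is_derive_odds (g : curve) (w : list bool) (t : R) :
  regular g t -> is_derive (odds g w) t (kap g w t * odds g w t).
Proof.
intros (H & Db & D0 & D1); destruct (core_factors _ _ _ H) as (Hb & Hu & Hv & _).
induction w as [|[|] w IH]; simpl.
- auto_derive; [repeat split; auto; lra|].
  change (Derive (fun x => b1 g x) t) with (Derive (b1 g) t).
  field; lra.
- pose proof (odds_pos g w t H) as Ho.
  assert (Ex : ex_derive (odds g w) t) by (eexists; exact IH).
  unfold factor1, ldfactor1, prob.
  auto_derive; [repeat split; auto; lra|].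
  replace (Derive (fun x => odds g w x) t) with (kap g w t * odds g w t)
    by (symmetry; apply is_derive_unique, IH).
  change (Derive (fun x => b1 g x) t) with (Derive (b1 g) t).
  change (Derive (fun x => c1 g x) t) with (Derive (c1 g) t).
  field; lra.
- pose proof (odds_pos g w t H) as Ho.
  assert (Ex : ex_derive (odds g w) t) by (eexists; exact IH).
  unfold factor0, ldfactor0, prob.
  auto_derive; [repeat split; auto; lra|].
  replace (Derive (fun x => odds g w x) t) with (kap g w t * odds g w t)
    by (symmetry; apply is_derive_unique, IH).
  change (Derive (fun x => b1 g x) t) with (Derive (b1 g) t).
  change (Derive (fun x => c0 g x) t) with (Derive (c0 g) t).
  field; lra.
Qed.

Lemma is_derive_prob (g : curve) (w : list bool) (t : R) :
  regular g t ->
  is_derive (prob g w) t ((1 - prob g w t) * kap g w t * prob g w t).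
Proof.
intros Hr; pose proof (is_derive_odds g w t Hr) as D.
destruct Hr as [H _]; pose proof (odds_pos g w t H) as Ho.
unfold prob. auto_derive.
- repeat split; try (eexists; exact D); lra.
- replace (Derive (fun x => odds g w x) t) with (kap g w t * odds g w t)
    by (symmetry; apply is_derive_unique, D).
  field; lra.
Qed.

Lemma is_derive_mass (g : curve) (w : list bool) (t : R) :
  regular g t -> is_derive (mass g w) t (lder g w t * mass g w t).
Proof.
intros Hr; induction w as [|[|] w IH]; simpl.
- auto_derive; trivial; ring.
- pose proof (is_derive_prob g w t Hr) as D.
  auto_derive; [split; [eexists; exact IH|split; [eexists; exact D|trivial]]|].
  replace (Derive (fun x => mass g w x) t) with (lder g w t * mass g w t)
    by (symmetry; apply is_derive_unique, IH).
  replace (Derive (fun x => prob g w x) t) with ((1 - prob g w t) * kap g w t * prob g w t)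
    by (symmetry; apply is_derive_unique, D).
  ring.
- pose proof (is_derive_prob g w t Hr) as D.
  auto_derive; [split; [eexists; exact IH|split; [eexists; exact D|trivial]]|].
  replace (Derive (fun x => mass g w x) t) with (lder g w t * mass g w t)
    by (symmetry; apply is_derive_unique, IH).
  replace (Derive (fun x => prob g w x) t) with ((1 - prob g w t) * kap g w t * prob g w t)
    by (symmetry; apply is_derive_unique, D).
  ring.
Qed.

Lemma is_derive_low (g : curve) (w : list bool) (t : R) :
  regular g t -> is_derive (low g w) t (dlow g w t).
Proof.
intros Hr; induction w as [|[|] w IH]; simpl low; simpl dlow.
- auto_derive; trivial.
- apply (is_derive_plus (low g w) (mass g (false :: w))); [exact IH|].
  apply (is_derive_mass g (false :: w) t Hr).
- exact IH.
Qed.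

Lemma locally_bound (f : R -> R) (e : R) :
  continuous f 0 -> 0 < e -> locally 0 (fun t => Rabs (f t - f 0) < e).
Proof.
intros Hf He.
apply (Hf (fun y => Rabs (y - f 0) < e)).
exists (mkposreal e He); intros y Hy; exact Hy.
Qed.

(* The state space of the odds: an interval that both digit maps preserve,
   uniformly for t near 0. *)
Lemma locally_odds_bounds (g : curve) :
  locally 0 (regular g) ->
  exists lo hi, 0 < lo /\ 0 < hi /\
    locally 0 (fun t => forall w, lo <= odds g w t <= hi).
Proof.
intros Hreg.
destruct (locally_singleton _ _ Hreg) as (H & Db & D0 & D1).
destruct (core_factors _ _ _ H) as (Hb & Hu & Hv & Hf0 & Hf1 & _).
assert (C0 : continuous (odds g nil) 0).
{ apply (ex_derive_continuous (odds g nil)); eexists; apply is_derive_odds.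
  repeat split; auto; apply H. }
assert (Ca : continuous (factor0 g) 0).
{ apply (ex_derive_continuous (factor0 g)). unfold factor0; auto_derive; auto. }
assert (Cb : continuous (factor1 g) 0).
{ apply (ex_derive_continuous (factor1 g)). unfold factor1; auto_derive.
  repeat split; auto; lra. }
set (o := odds g nil 0) in *. set (a := factor0 g 0) in *. set (b := factor1 g 0) in *.
assert (Ho : 0 < o) by (apply odds_pos, H).
assert (Ha : 0 < a < 1).
{ unfold a, factor0; split; [apply Rmult_lt_0_compat|]; lra. }
assert (Hb1 : 1 < b) by exact Hf1.
pose (e := Rmin (o / 2) (Rmin (a / 2) (Rmin ((1 - a) / 2) ((b - 1) / 2)))).
assert (He : 0 < e) by (unfold e; repeat apply Rmin_glb_lt; lra).
assert (E1 : e <= o / 2) by apply Rmin_l.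
assert (E2 : e <= a / 2) by (eapply Rle_trans; [apply Rmin_r|apply Rmin_l]).
assert (E3 : e <= (1 - a) / 2)
  by (eapply Rle_trans; [apply Rmin_r|eapply Rle_trans; [apply Rmin_r|apply Rmin_l]]).
assert (E4 : e <= (b - 1) / 2)
  by (eapply Rle_trans; [apply Rmin_r|eapply Rle_trans; [apply Rmin_r|apply Rmin_r]]).
(* Near t = 0, [lo] survives a digit 0 because [factor0] is at least a/2, and a digit 1 because
   [factor1] is at least 1 + lo. The bound [hi] survives a digit 0 because [factor0] is at most
   (1+a)/2 while hi (1-a) is at least 2, and a digit 1 because [factor1] is at most 2b. *)
pose (lo := Rmin (o / 2) (Rmin (a / 2) ((b - 1) / 2))).
pose (hi := Rmax (2 * o) (Rmax (2 * b) (2 / (1 - a)))).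
assert (L1 : lo <= o / 2) by apply Rmin_l.
assert (L2 : lo <= a / 2) by (eapply Rle_trans; [apply Rmin_r|apply Rmin_l]).
assert (L3 : lo <= (b - 1) / 2) by (eapply Rle_trans; [apply Rmin_r|apply Rmin_r]).
assert (L0 : 0 < lo) by (unfold lo; repeat apply Rmin_glb_lt; lra).
assert (U1 : 2 * o <= hi) by apply Rmax_l.
assert (U2 : 2 * b <= hi) by (eapply Rle_trans; [apply Rmax_l|apply Rmax_r]).
assert (U3 : 2 / (1 - a) <= hi) by (eapply Rle_trans; [apply Rmax_r|apply Rmax_r]).
exists lo, hi; split; [exact L0|split; [lra|]].
generalize (filter_and _ _ (locally_bound _ e C0 He)
  (filter_and _ _ (locally_bound _ e Ca He) (locally_bound _ e Cb He))).
apply filter_imp; intros t (T1 & T2 & T3).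
fold o in T1; fold a in T2; fold b in T3.
apply Rabs_def2 in T1; apply Rabs_def2 in T2; apply Rabs_def2 in T3.
assert (Ua : 2 <= hi * (1 - a)) by (apply Rle_div_l in U3; lra).
induction w as [|[|] w IH]; [change (lo <= odds g nil t <= hi); lra| |]; simpl odds;
  set (s := odds g w t) in *.
- assert (P : 0 < s / (1 + s)) by (apply Rdiv_lt_0_compat; lra).
  assert (P1 : s / (1 + s) < 1) by (apply Rlt_div_l; lra).
  assert (P2 : lo <= (1 + lo) * (s / (1 + s))).
  { unfold Rdiv; rewrite <- Rmult_assoc; apply (Rle_div_r lo); nra. }
  split; nra.
- split; nra.
Qed.

(** The recursion for [kap] contracts by at least the factor 1 - A, so a ball absorbs the forcing
    term as soon as its radius is the size of that term divided by A. *)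
Lemma kap_step_bound (p K A k l : R) : 0 <= p -> p <= 1 - A -> 0 < A ->
  Rabs k <= K -> Rabs l <= A * K -> Rabs (l + p * k) <= K.
Proof.
intros Hp Hp1 HA Hk Hl.
eapply Rle_trans; [apply Rabs_triang|].
rewrite Rabs_mult, (Rabs_pos_eq p) by lra.
assert (p * Rabs k <= (1 - A) * K).
{ apply Rmult_le_compat; try lra. apply Rabs_pos. }
lra.
Qed.

Lemma locally_le_bound (f : R -> R) :
  continuous f 0 -> exists M, 0 < M /\ locally 0 (fun t => Rabs (f t) <= M).
Proof.
intros Hf; exists (Rabs (f 0) + 1); split; [pose proof (Rabs_pos (f 0)); lra|].
generalize (locally_bound f 1 Hf Rlt_0_1); apply filter_imp; intros t Ht.
replace (f t) with (f 0 + (f t - f 0)) by ring.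
eapply Rle_trans; [apply Rabs_triang|]; lra.
Qed.

Definition uniform (g : curve) (r K t : R) : Prop :=
  regular g t /\
  forall w, r <= prob g w t <= 1 - r /\ Rabs (kap g w t) <= K.

(** A bound at t = 0 alone would not do: the limit along the digits of a point is differentiated in
    t, which needs one pair of constants for all t near 0. *)
Lemma locally_uniform (g : curve) :
  locally 0 (regular g) ->
  continuous (Derive (b1 g)) 0 -> continuous (Derive (c0 g)) 0 ->
  continuous (Derive (c1 g)) 0 ->
  exists r K, 0 < r /\ 0 < K /\ locally 0 (uniform g r K).
Proof.
intros Hreg Cb C0 C1.
destruct (locally_odds_bounds g Hreg) as (lo & hi & Hlo & Hhi & Hodds).
destruct (locally_singleton _ _ Hreg) as (H & Db & D0 & D1).
destruct (core_factors _ _ _ H) as (Hb & Hu & Hv & Hf0 & Hf1 & _).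
assert (Kb : continuous (b1 g) 0) by (apply (ex_derive_continuous (b1 g)), Db).
assert (K0 : continuous (c0 g) 0) by (apply (ex_derive_continuous (c0 g)), D0).
assert (K1 : continuous (c1 g) 0) by (apply (ex_derive_continuous (c1 g)), D1).
assert (Cdiv : forall f h : R -> R, continuous f 0 -> continuous h 0 -> h 0 <> 0 ->
  continuous (fun t => f t / h t) 0).
{ intros f h Hf Hh Hn; apply (continuous_mult f (fun t => / h t)); [exact Hf|].
  apply continuous_comp with (g := Rinv); [exact Hh|].
  apply continuous_Rinv, Hn. }
assert (Cc : forall f : R -> R, continuous f 0 -> continuous (fun t => 1 + f t) 0).
{ intros f Hf; apply (continuous_plus (fun _ => 1) f); [apply continuous_const|exact Hf]. }
assert (Cm : forall f : R -> R, continuous f 0 -> continuous (fun t => 1 - f t) 0).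
{ intros f Hf; apply (continuous_minus (fun _ => 1) f); [apply continuous_const|exact Hf]. }
destruct (locally_le_bound (kap g nil)) as (M & HM & LM).
{ simpl kap; apply (Cdiv (Derive (b1 g)) (fun t => b1 g t * (1 - b1 g t))); auto.
  - apply (continuous_mult (b1 g) (fun t => 1 - b1 g t)); auto.
  - apply Rgt_not_eq, Rmult_lt_0_compat; lra. }
destruct (locally_le_bound (ldfactor0 g)) as (M0 & HM0 & LM0).
{ apply (continuous_plus (fun t => Derive (b1 g) t / b1 g t)
    (fun t => Derive (c0 g) t / (1 + c0 g t))); apply Cdiv; auto; lra. }
destruct (locally_le_bound (ldfactor1 g)) as (M1 & HM1 & LM1).
{ apply (continuous_plus (fun t => Derive (c1 g) t / (1 + c1 g t))
    (fun t => Derive (b1 g) t / (1 - b1 g t))); apply Cdiv; auto; lra. }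
pose (r := Rmin (lo / (1 + lo)) (1 / (1 + hi))).
assert (R1 : r <= lo / (1 + lo)) by apply Rmin_l.
assert (R2 : r <= 1 / (1 + hi)) by apply Rmin_r.
assert (Hr : 0 < r) by (apply Rmin_glb_lt; apply Rdiv_lt_0_compat; lra).
(* [M] covers the empty word; the other two terms make r K dominate the forcing terms [ldfactor0]
   and [ldfactor1], as [kap_step_bound] requires. *)
pose (K := M + M0 / r + M1 / r).
assert (Q0 : 0 < M0 / r) by (apply Rdiv_lt_0_compat; lra).
assert (Q1 : 0 < M1 / r) by (apply Rdiv_lt_0_compat; lra).
assert (KM0 : M0 <= r * K).
{ replace M0 with (r * (M0 / r)) by (field; lra).
  apply Rmult_le_compat_l; unfold K; lra. }
assert (KM1 : M1 <= r * K).
{ replace M1 with (r * (M1 / r)) by (field; lra).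
  apply Rmult_le_compat_l; unfold K; lra. }
exists r, K; split; [exact Hr|split; [unfold K; lra|]].
generalize (filter_and _ _ Hreg (filter_and _ _ Hodds
  (filter_and _ _ LM (filter_and _ _ LM0 LM1)))).
apply filter_imp; intros t (T0 & T1 & T2 & T3 & T4).
split; [exact T0|].
assert (P : forall w, r <= prob g w t <= 1 - r).
{ intros w; specialize (T1 w); unfold prob; set (s := odds g w t) in *.
  assert (Hs : s / (1 + s) = 1 - 1 / (1 + s)) by (field; lra).
  split.
  - apply Rle_trans with (1 := R1).
    apply (Rle_div_l lo); [lra|].
    replace (s / (1 + s) * (1 + lo)) with (s * (1 + lo) / (1 + s)) by (field; lra).
    apply Rle_div_r; lra.
  - rewrite Hs; apply Rplus_le_compat_l, Ropp_le_contravar, Rle_trans with (1 := R2).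
    unfold Rdiv; apply Rmult_le_compat_l; [lra|apply Rinv_le_contravar; lra]. }
intros w; split; [apply P|].
induction w as [|[|] w IH].
- unfold K; lra.
- simpl kap; pose proof (P w).
  apply kap_step_bound with (A := r); try lra.
- simpl kap; pose proof (P w).
  apply kap_step_bound with (A := r); try lra.
Qed.

(** * Values of the de Rham function on dyadic intervals *)

Fixpoint left (w : list bool) : R :=
  match w with
  | nil => 0
  | false :: w' => left w'
  | true :: w' => left w' + / 2 ^ S (length w')
  end.

Definition width (w : list bool) : R := / 2 ^ length w.

Lemma width_pos (w : list bool) : 0 < width w.
Proof. apply Rinv_0_lt_compat, pow_lt; lra. Qed.

Lemma width_cons (i : bool) (w : list bool) : width (i :: w) = width w / 2.
Proof. unfold width; simpl; field; apply pow_nonzero; lra. Qed.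

Lemma left_true (w : list bool) : left (true :: w) = left w + width w / 2.
Proof. simpl left; f_equal; change (width (true :: w) = width w / 2); apply width_cons. Qed.

(* The Möbius bijection of [0,1] fixing 0 and 1 with derivative v at 0. *)
Definition psi (v z : R) : R := v * z / (1 + (v - 1) * z).

Lemma psi_den (v z : R) : 0 < v -> 0 <= z <= 1 -> 0 < 1 + (v - 1) * z.
Proof. intros; destruct (Rle_dec v 1); nra. Qed.

Lemma psi_bounds (v z : R) : 0 < v -> 0 <= z <= 1 -> 0 <= psi v z <= 1.
Proof.
intros Hv Hz; pose proof (psi_den v z Hv Hz); unfold psi; split.
- apply Rle_div_r; nra.
- apply Rle_div_l; nra.
Qed.

Lemma psi_0 (v : R) : psi v 0 = 0.
Proof. unfold psi, Rdiv; rewrite Rmult_0_r; ring. Qed.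

Lemma psi_1 (v : R) : 0 < v -> psi v 1 = 1.
Proof. intros; unfold psi; field; lra. Qed.

(** The parameter v of the map [psi v] that turns F into its rescaled copy on the interval of [w].
    Dividing by the odds of [0,1] makes v = 1 for the empty word. *)
Definition rel_odds (g : curve) (w : list bool) (t : R) : R :=
  odds g w t / odds g nil t.

Lemma rel_odds_pos (g : curve) (w : list bool) (t : R) :
  core (b1 g t) (c0 g t) (c1 g t) -> 0 < rel_odds g w t.
Proof. intros H; apply Rdiv_lt_0_compat; apply odds_pos, H. Qed.

Lemma den_pos (c z : R) : 0 < 1 + c -> 0 <= z <= 1 -> 0 < c * z + 1.
Proof. intros; destruct (Rle_dec 0 c); nra. Qed.

(** Both sides are Möbius maps of z vanishing at 0. At z = 1 they agree as well, since
    [Phi (A0 g t) 1] is b1 and [psi] multiplies the odds b1/(1-b1) by [rel_odds]. The recursion for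
    [odds] matches the derivatives at 0. *)
Lemma psi_Phi_false (g : curve) (w : list bool) (t z : R) :
  core (b1 g t) (c0 g t) (c1 g t) -> 0 <= z <= 1 ->
  psi (rel_odds g w t) (Phi (A0 g t) z) = prob g w t * psi (rel_odds g (false :: w) t) z.
Proof.
intros H Hz; destruct (core_factors _ _ _ H) as (Hb & Hu & Hv & _).
pose proof (odds_pos g w t H) as Ho.
pose proof (psi_den _ z (rel_odds_pos g (false :: w) t H) Hz) as Hd.
pose proof (den_pos _ z Hu Hz) as He.
revert Hd; unfold psi, rel_odds, prob, Phi; simpl; unfold factor0.
set (o := odds g w t) in *; set (b := b1 g t) in *; set (u := c0 g t) in *.
intros Hd.
assert (E : 1 + (b * (1 + u) * (1 + o) / (b / (1 - b)) - 1) * z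
  = 1 + ((1 + u) * (1 - b) * (1 + o) - 1) * z) by (field; lra).
rewrite E in *.
assert (E2 : 1 + (o / (b / (1 - b)) - 1) * ((b * (1 + u) * z + 0) / (u * z + 1))
  = (1 + ((1 + u) * (1 - b) * (1 + o) - 1) * z) / (u * z + 1)) by (field; lra).
rewrite E2; field; repeat split; lra.
Qed.

Lemma psi_Phi_true (g : curve) (w : list bool) (t z : R) :
  core (b1 g t) (c0 g t) (c1 g t) -> 0 <= z <= 1 ->
  psi (rel_odds g w t) (Phi (A1 g t) z)
  = prob g w t + (1 - prob g w t) * psi (rel_odds g (true :: w) t) z.
Proof.
intros H Hz; destruct (core_factors _ _ _ H) as (Hb & Hu & Hv & _).
pose proof (odds_pos g w t H) as Ho.
pose proof (psi_den _ z (rel_odds_pos g (true :: w) t H) Hz) as Hd.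
pose proof (den_pos _ z Hv Hz) as He.
revert Hd; unfold psi, rel_odds, prob, Phi; simpl; unfold factor1.
set (o := odds g w t) in *; set (b := b1 g t) in *; set (u := c1 g t) in *.
intros Hd.
assert (E : 1 + ((1 + u) / (1 - b) * (o / (1 + o)) / (b / (1 - b)) - 1) * z
  = (b * (1 + o) + ((1 + u) * o - b * (1 + o)) * z) / (b * (1 + o))) by (field; lra).
rewrite E in *.
assert (Hd2 : 0 < b * (1 + o) + ((1 + u) * o - b * (1 + o)) * z).
{ assert (P : 0 < b * (1 + o)) by nra.
  apply (Rmult_lt_compat_r _ _ _ P) in Hd. unfold Rdiv in Hd.
  rewrite Rmult_assoc, Rinv_l in Hd; lra. }
assert (E2 : 1 + (o / (b / (1 - b)) - 1) * (((1 - b + u) * z + b) / (u * z + 1))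
  = (1 - b) * (b * (1 + o) + ((1 + u) * o - b * (1 + o)) * z) / (b * (u * z + 1))) by (field; lra).
rewrite E2; field; repeat split; lra.
Qed.

(** The functional equation makes f(0) a fixed point of the first Möbius map. The factor left after
    removing the root 0 is affine in z and positive at z = 0 and z = 1, so [0,1] contains no other
    fixed point. *)
Lemma solution_0 (g : curve) (t : R) (f : R -> R) :
  core (b1 g t) (c0 g t) (c1 g t) -> de_Rham_solution g t f -> f 0 = 0.
Proof.
intros H (_ & Hf & F0 & _); destruct (core_factors _ _ _ H) as (Hb & Hu & Hv & Ha & _).
specialize (F0 0 ltac:(lra)); specialize (Hf 0 ltac:(lra)).
rewrite Rmult_0_r in F0; unfold Phi in F0; simpl in F0.
pose proof (den_pos _ _ Hu Hf) as He; set (z := f 0) in *.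
assert (E : z * (c0 g t * z + 1) = b1 g t * (1 + c0 g t) * z).
{ rewrite F0 at 1; field; lra. }
assert (E2 : z * (c0 g t * z + 1 - b1 g t * (1 + c0 g t)) = 0) by lra.
apply Rmult_integral in E2; destruct E2 as [E2|E2]; [exact E2|].
exfalso; destruct (Rle_dec 0 (c0 g t)); nra.
Qed.

Lemma solution_1 (g : curve) (t : R) (f : R -> R) :
  core (b1 g t) (c0 g t) (c1 g t) -> de_Rham_solution g t f -> f 1 = 1.
Proof.
intros H (_ & Hf & _ & F1); destruct (core_factors _ _ _ H) as (Hb & Hu & Hv & _).
destruct H as (_ & _ & [Hv2 _]).
specialize (F1 1 ltac:(lra)); specialize (Hf 1 ltac:(lra)).
replace (2 * 1 - 1) with 1 in F1 by ring; unfold Phi in F1; simpl in F1.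
pose proof (den_pos _ _ Hv Hf) as He; set (z := f 1) in *.
assert (E : z * (c1 g t * z + 1) = (1 - b1 g t + c1 g t) * z + b1 g t).
{ rewrite F1 at 1; field; lra. }
assert (E2 : (z - 1) * (c1 g t * z + b1 g t) = 0) by lra.
apply Rmult_integral in E2; destruct E2 as [E2|E2]; [lra|].
exfalso; destruct (Rle_dec 0 (c1 g t)); nra.
Qed.

(** Words carry the newest digit in front because it acts innermost: the functional equation
    replaces f at a point of a half by a Möbius image of f(s), and the identities above move that
    image through [psi]. *)
Lemma solution_cylinder (g : curve) (t : R) (f : R -> R) :
  core (b1 g t) (c0 g t) (c1 g t) -> de_Rham_solution g t f ->
  forall w s, 0 <= s <= 1 ->
  f (left w + s * width w) = low g w t + mass g w t * psi (rel_odds g w t) (f s).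
Proof.
intros H Hf w; pose proof Hf as (_ & Hr & F0 & F1).
induction w as [|[|] w IH]; intros s Hs.
- pose proof (Hr s Hs).
  unfold width, rel_odds; simpl.
  replace (b1 g t / (1 - b1 g t) / (b1 g t / (1 - b1 g t))) with 1
    by (field; destruct H; lra).
  unfold psi; replace (0 + s * / 1) with s by field; field; lra.
- rewrite left_true, width_cons.
  replace (left w + width w / 2 + s * (width w / 2))
    with (left w + (1 + s) / 2 * width w) by field.
  rewrite IH, F1 by lra.
  replace (2 * ((1 + s) / 2) - 1) with s by field.
  rewrite psi_Phi_true by auto; simpl; ring.
- rewrite width_cons; simpl left.
  replace (left w + s * (width w / 2)) with (left w + s / 2 * width w) by field.
  rewrite IH, F0 by lra.
  replace (2 * (s / 2)) with s by field.
  rewrite psi_Phi_false by auto; simpl; ring.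
Qed.

Lemma solution_left (g : curve) (t : R) (f : R -> R) (w : list bool) :
  core (b1 g t) (c0 g t) (c1 g t) -> de_Rham_solution g t f ->
  f (left w) = low g w t.
Proof.
intros H Hf; replace (left w) with (left w + 0 * width w) by ring.
rewrite (solution_cylinder g t f H Hf) by lra.
rewrite (solution_0 g t f H Hf), psi_0; ring.
Qed.

Lemma solution_right (g : curve) (t : R) (f : R -> R) (w : list bool) :
  core (b1 g t) (c0 g t) (c1 g t) -> de_Rham_solution g t f ->
  f (left w + width w) = low g w t + mass g w t.
Proof.
intros H Hf; replace (width w) with (1 * width w) by ring.
rewrite (solution_cylinder g t f H Hf) by lra.
rewrite (solution_1 g t f H Hf), psi_1 by (apply rel_odds_pos, H); ring.
Qed.

(** This is the form in which monotonicity of F enters: a value inside a dyadic interval is compared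
    with the values at its ends. *)
Lemma solution_within (g : curve) (t : R) (f : R -> R) (w : list bool) (x : R) :
  core (b1 g t) (c0 g t) (c1 g t) -> de_Rham_solution g t f ->
  left w <= x <= left w + width w ->
  low g w t <= f x <= low g w t + mass g w t.
Proof.
intros H Hf Hx; pose proof (width_pos w) as Hw.
assert (Hs : 0 <= (x - left w) / width w <= 1).
{ split; [apply Rle_div_r; lra|apply Rle_div_l; lra]. }
replace x with (left w + (x - left w) / width w * width w) by (field; lra).
rewrite (solution_cylinder g t f H Hf) by exact Hs.
destruct (psi_bounds (rel_odds g w t) (f ((x - left w) / width w))).
- apply rel_odds_pos, H.
- apply Hf, Hs.
- pose proof (mass_pos g w t H); nra.
Qed.

(** The first n binary digits of x by bisection. A tie goes right, in agreement with the floor in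
    [digit]. *)
Fixpoint pre (x : R) (n : nat) : list bool :=
  match n with
  | O => nil
  | S n => (if Rle_lt_dec (left (pre x n) + width (pre x n) / 2) x
            then true else false) :: pre x n
  end.

Lemma length_pre (x : R) (n : nat) : length (pre x n) = n.
Proof. induction n; simpl; auto. Qed.

Lemma width_pre (x : R) (n : nat) : width (pre x n) = / 2 ^ n.
Proof. unfold width; rewrite length_pre; reflexivity. Qed.

Lemma pre_bounds (x : R) (n : nat) : 0 <= x <= 1 ->
  left (pre x n) <= x <= left (pre x n) + width (pre x n).
Proof.
intros Hx; induction n as [|n IH]; simpl pre.
- unfold width; simpl; lra.
- destruct (Rle_lt_dec _ _); rewrite width_cons.
  + rewrite left_true; lra.
  + simpl left; lra.
Qed.

Lemma pre_bounds_strict (x : R) (n : nat) : 0 <= x < 1 ->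
  left (pre x n) <= x < left (pre x n) + width (pre x n).
Proof.
intros Hx; induction n as [|n IH]; simpl pre.
- unfold width; simpl; lra.
- destruct (Rle_lt_dec _ _); rewrite width_cons.
  + rewrite left_true; lra.
  + simpl left; lra.
Qed.

(* Bernoulli's inequality for (1 + d)^n with (1 + d) l < 1. *)
Lemma geometric_dominates_linear (l : R) : 0 < l < 1 ->
  exists C m, 0 < C /\ 0 < m < 1 /\ forall n, (INR n + 1) * l ^ n <= C * m ^ n.
Proof.
intros Hl; pose (d := (1 - l) / 2).
assert (Hd : 0 < d <= 1) by (unfold d; lra).
exists (1 / d), ((1 + d) * l); split; [apply Rdiv_lt_0_compat; lra|split].
- unfold d; nra.
- intros n; pose proof (poly n d ltac:(lra)) as Hp; pose proof (pow_lt l n ltac:(lra)).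
  rewrite Rpow_mult_distr.
  apply Rle_trans with ((1 / d * (1 + d) ^ n) * l ^ n); [|lra].
  apply Rmult_le_compat_r; [lra|].
  replace (1 / d * (1 + d) ^ n) with ((1 + d) ^ n / d) by (field; lra).
  apply Rle_div_r; [lra|].
  assert (0 <= INR n) by apply pos_INR; nra.
Qed.

Lemma Rabs_add_bound (a b A B : R) : Rabs a <= A -> Rabs b <= B -> Rabs (a + b) <= A + B.
Proof. intros; eapply Rle_trans; [apply Rabs_triang|lra]. Qed.

(** Termwise differentiation when the derivatives are uniformly Cauchy at rate [r] near 0. The
    explicit bound on the distance to [dfn O 0] later yields a bound on f1 that is uniform in x. *)
Lemma is_derive_limit (fn dfn : nat -> R -> R) (f : R -> R) (r : nat -> R) :
  is_lim_seq r 0 -> (forall n, 0 <= r n) ->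
  locally 0 (fun t =>
    (forall n, is_derive (fn n) t (dfn n t)) /\
    (forall n m, (n <= m)%nat -> Rabs (dfn m t - dfn n t) <= r n) /\
    is_lim_seq (fun n => fn n t) (f t)) ->
  exists l, is_derive f 0 l /\ Rabs (l - dfn O 0) <= r O.
Proof.
intros Hr Hr0 [tau Hloc].
assert (H0 : ball (0 : R) tau (0 : R)) by apply ball_center.
assert (Cau : ex_finite_lim_seq (fun n => dfn n 0)).
{ apply ex_lim_seq_cauchy_corr; intros e.
  apply is_lim_seq_spec in Hr; destruct (Hr (mkposreal (e / 2) (is_pos_div_2 e))) as [N HN].
  exists N; intros n m Hn Hm; simpl in HN.
  specialize (HN N (Nat.le_refl N)); rewrite Rminus_0_r, Rabs_pos_eq in HN by auto.
  destruct (Hloc 0 H0) as (_ & Hc & _).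
  pose proof (Hc N n Hn) as A1; pose proof (Hc N m Hm) as A2.
  replace (dfn n 0 - dfn m 0) with ((dfn n 0 - dfn N 0) + - (dfn m 0 - dfn N 0)) by ring.
  eapply Rle_lt_trans; [apply Rabs_triang|]; rewrite Rabs_Ropp; lra. }
destruct Cau as [l Hl].
assert (Tail : forall n, Rabs (l - dfn n 0) <= r n).
{ intros n.
  apply (is_lim_seq_le_loc (fun m => Rabs (dfn m 0 - dfn n 0)) (fun _ => r n)
    (Rabs (l - dfn n 0)) (r n)).
  - exists n; intros m Hm; apply (Hloc 0 H0); exact Hm.
  - apply (is_lim_seq_abs _ (l - dfn n 0)).
    apply is_lim_seq_minus'; [exact Hl|apply is_lim_seq_const].
  - apply is_lim_seq_const. }
exists l; split; [|apply Tail].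
apply is_derive_Reals; intros e He.
apply is_lim_seq_spec in Hr; destruct (Hr (mkposreal (e / 4) ltac:(lra))) as [N HN].
specialize (HN N (Nat.le_refl N)); simpl in HN; rewrite Rminus_0_r, Rabs_pos_eq in HN by auto.
destruct (Hloc 0 H0) as (DN & _); specialize (DN N); apply is_derive_Reals in DN.
destruct (DN (e / 4) ltac:(lra)) as [d Hd].
assert (Hm : 0 < Rmin d tau) by (apply Rmin_glb_lt; [apply d|apply tau]).
exists (mkposreal _ Hm); intros h Hh0 Hh; simpl in Hh.
assert (h_d : Rabs h < d) by (eapply Rlt_le_trans; [exact Hh|apply Rmin_l]).
assert (h_t : Rabs h < tau) by (eapply Rlt_le_trans; [exact Hh|apply Rmin_r]).
specialize (Hd h Hh0 h_d); rewrite Rplus_0_l in *.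
assert (Ball : forall s, Rabs (s - 0) <= Rabs (h - 0) -> ball (0 : R) tau s).
{ intros s Hs; change (Rabs (s - 0) < tau); rewrite (Rminus_0_r h) in Hs; lra. }
(* The mean value inequality for [fn m] - [fn N] has a constant independent of m, so it passes to
   the limit f. *)
assert (MV : forall m, (N <= m)%nat ->
  Rabs ((fn m h - fn N h) - (fn m 0 - fn N 0)) <= r N * Rabs h).
{ intros m Hm'.
  replace (Rabs h) with (Rabs (h - 0)) by (rewrite Rminus_0_r; reflexivity).
  apply (bounded_variation (fun s => fn m s - fn N s) (fun s => dfn m s - dfn N s)).
  intros s Hs; destruct (Hloc s (Ball s Hs)) as (A & B & _).
  split; [|apply B, Hm'].
  apply (is_derive_minus (fn m) (fn N)); apply A. }
assert (Lim : Rabs ((f h - fn N h) - (f 0 - fn N 0)) <= r N * Rabs h).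
{ apply (is_lim_seq_le_loc (fun m => Rabs ((fn m h - fn N h) - (fn m 0 - fn N 0)))
    (fun _ => r N * Rabs h) (Rabs ((f h - fn N h) - (f 0 - fn N 0))) (r N * Rabs h)).
  - exists N; exact MV.
  - apply (is_lim_seq_abs _ ((f h - fn N h) - (f 0 - fn N 0))).
    apply is_lim_seq_minus'; apply is_lim_seq_minus'; try apply is_lim_seq_const.
    + apply (Hloc h), Ball; lra.
    + apply (Hloc 0 H0).
  - apply is_lim_seq_const. }
pose proof (Rabs_pos_lt h Hh0) as Hpos.
replace ((f h - f 0) / h - l) with
  (((fn N h - fn N 0) / h - dfn N 0) + (((f h - fn N h) - (f 0 - fn N 0)) / h
    + - (l - dfn N 0))) by (field; exact Hh0).
assert (A1 : Rabs (((f h - fn N h) - (f 0 - fn N 0)) / h) <= r N).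
{ unfold Rdiv; rewrite Rabs_mult, Rabs_inv; apply Rle_div_l; lra. }
pose proof (Tail N) as A2; rewrite <- Rabs_Ropp in A2.
pose proof (Rabs_add_bound _ _ _ _ A1 A2) as A3.
eapply Rle_lt_trans; [apply Rabs_triang|]; lra.
Qed.

(** * Existence and estimates of the derivative in t *)

Lemma uniform_r (g : curve) (r K t : R) : uniform g r K t -> r < 1.
Proof.
intros [Hr Hu]; destruct (Hu nil) as [A _].
destruct (prob_bounds g nil t (proj1 Hr)); lra.
Qed.

Lemma lder_step (g : curve) (r K t : R) (i : bool) (w : list bool) :
  0 < r -> uniform g r K t ->
  Rabs (lder g (i :: w) t - lder g w t) <= K.
Proof.
intros Hr [_ Hu]; destruct (Hu w) as [Hp Hk].
assert (E : forall p, 0 <= p <= 1 -> Rabs (p * kap g w t) <= K).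
{ intros p H1; rewrite Rabs_mult, Rabs_pos_eq by lra.
  pose proof (Rabs_pos (kap g w t)); nra. }
destruct i; simpl.
- replace (lder g w t - prob g w t * kap g w t - lder g w t)
    with (- (prob g w t * kap g w t)) by ring.
  rewrite Rabs_Ropp; apply E; lra.
- replace (lder g w t + (1 - prob g w t) * kap g w t - lder g w t)
    with ((1 - prob g w t) * kap g w t) by ring.
  apply E; lra.
Qed.

Lemma lder_app (g : curve) (r K t : R) (u w : list bool) :
  0 < r -> uniform g r K t ->
  Rabs (lder g (u ++ w) t - lder g w t) <= K * INR (length u).
Proof.
intros Hr Hu; induction u as [|i u IH].
- simpl; rewrite Rminus_diag, Rabs_R0, Rmult_0_r; lra.
- change ((i :: u) ++ w) with (i :: (u ++ w)); change (length (i :: u)) with (S (length u)).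
  rewrite S_INR; pose proof (lder_step g r K t i (u ++ w) Hr Hu) as A.
  replace (lder g (i :: u ++ w) t - lder g w t) with
    (lder g (i :: u ++ w) t - lder g (u ++ w) t + (lder g (u ++ w) t - lder g w t)) by ring.
  pose proof (Rabs_add_bound _ _ _ _ A IH); lra.
Qed.

Lemma lder_bound (g : curve) (r K t : R) (w : list bool) :
  0 < r -> uniform g r K t -> Rabs (lder g w t) <= K * INR (length w).
Proof.
intros Hr Hu; pose proof (lder_app g r K t w nil Hr Hu) as A.
rewrite app_nil_r in A; simpl lder in A at 2; rewrite Rminus_0_r in A; exact A.
Qed.

Lemma mass_app_bounds (g : curve) (r K t : R) (u w : list bool) :
  0 < r -> uniform g r K t ->
  r ^ length u * mass g w t <= mass g (u ++ w) t <= (1 - r) ^ length u * mass g w t.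
Proof.
intros Hr Hu; pose proof (uniform_r g r K t Hu) as Hr1.
pose proof (mass_pos g w t (proj1 (proj1 Hu))) as Hm.
induction u as [|i u IH]; [simpl; lra|].
change ((i :: u) ++ w) with (i :: (u ++ w)); change (length (i :: u)) with (S (length u)).
rewrite <- !tech_pow_Rmult.
destruct (proj2 Hu (u ++ w)) as [Hp _].
pose proof (pow_lt r (length u) Hr).
pose proof (pow_lt (1 - r) (length u) ltac:(lra)).
set (x := r ^ length u) in *; set (y := (1 - r) ^ length u) in *.
assert (0 <= x * mass g w t) by nra.
destruct i; simpl; split.
- replace (r * x * mass g w t) with (x * mass g w t * r) by ring.
  apply Rmult_le_compat; lra.
- replace ((1 - r) * y * mass g w t) with (y * mass g w t * (1 - r)) by ring.
  apply Rmult_le_compat; lra.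
- replace (r * x * mass g w t) with (x * mass g w t * r) by ring.
  apply Rmult_le_compat; lra.
- replace ((1 - r) * y * mass g w t) with (y * mass g w t * (1 - r)) by ring.
  apply Rmult_le_compat; lra.
Qed.

(** A digit 1 adds the t-derivative of one mass: a logarithmic derivative that is linear in the
    length, times a mass that decays geometrically. *)
Lemma dlow_step (g : curve) (r K t : R) (i : bool) (w : list bool) :
  0 < r -> 0 <= K -> uniform g r K t ->
  Rabs (dlow g (i :: w) t - dlow g w t)
    <= K * ((INR (length w) + 1) * (1 - r) ^ length w).
Proof.
intros Hr HK Hu; pose proof (uniform_r g r K t Hu) as Hr1.
pose proof (pos_INR (length w)); pose proof (pow_lt (1 - r) (length w) ltac:(lra)).
destruct i.
- change (dlow g (true :: w) t) with
    (dlow g w t + lder g (false :: w) t * mass g (false :: w) t).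
  replace (dlow g w t + lder g (false :: w) t * mass g (false :: w) t - dlow g w t)
    with (lder g (false :: w) t * mass g (false :: w) t) by ring.
  pose proof (lder_bound g r K t (false :: w) Hr Hu) as A.
  change (length (false :: w)) with (S (length w)) in A; rewrite S_INR in A.
  pose proof (mass_app_bounds g r K t w nil Hr Hu) as [_ B]; rewrite app_nil_r in B.
  simpl mass in B at 2; rewrite Rmult_1_r in B.
  pose proof (mass_split g w t).
  pose proof (mass_pos g (true :: w) t (proj1 (proj1 Hu))).
  pose proof (mass_pos g (false :: w) t (proj1 (proj1 Hu))).
  rewrite Rabs_mult, (Rabs_pos_eq (mass _ _ _)), <- Rmult_assoc by lra.
  apply Rmult_le_compat; try lra; apply Rabs_pos.
- simpl dlow; rewrite Rminus_diag, Rabs_R0; apply Rmult_le_pos; [|apply Rmult_le_pos]; lra.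
Qed.

Lemma telescope_bound (a : nat -> R) (c m : R) :
  0 <= c -> 0 < m < 1 -> (forall n, Rabs (a (S n) - a n) <= c * m ^ n) ->
  forall n k, (n <= k)%nat -> Rabs (a k - a n) <= c / (1 - m) * m ^ n.
Proof.
intros Hc Hm H n k Hk.
assert (P : Rabs (a k - a n) <= c / (1 - m) * (m ^ n - m ^ k)).
{ induction Hk as [|k Hk IH].
  - rewrite !Rminus_diag, Rabs_R0; lra.
  - replace (a (S k) - a n) with (a (S k) - a k + (a k - a n)) by ring.
    pose proof (Rabs_add_bound _ _ _ _ (H k) IH) as A.
    eapply Rle_trans; [exact A|right; simpl; field; lra]. }
eapply Rle_trans; [exact P|].
assert (0 <= c / (1 - m)) by (apply Rle_div_r; lra).
apply Rmult_le_compat_l; [lra|].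
pose proof (pow_lt m k ltac:(lra)); lra.
Qed.

(** The digits of s do not depend on t, so F(t,s) is, for all t near 0, the limit of [low] along one
    fixed sequence of words; the increments of [dlow] are summable uniformly in t. *)
Lemma is_derive_solution (g : curve) (F : R -> R -> R) (r K : R) :
  0 < r -> 0 <= K -> locally 0 (uniform g r K) ->
  locally 0 (fun t => de_Rham_solution g t (F t)) ->
  exists M, forall s, 0 <= s <= 1 ->
    is_derive (fun t => F t s) 0 (f1 F s) /\ Rabs (f1 F s) <= M.
Proof.
intros Hr HK Hu HF.
pose proof (uniform_r g r K 0 (locally_singleton _ _ Hu)) as Hr1.
destruct (geometric_dominates_linear (1 - r) ltac:(lra)) as (C & m & HC & Hm & Hlin).
(* The rate at n = 0, where [dlow] of the empty word is 0. *)
exists (K * C / (1 - m)); intros s Hs.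
assert (HKC : 0 <= K * C / (1 - m)).
{ apply Rle_div_r; [lra|]; rewrite Rmult_0_l; apply Rmult_le_pos; lra. }
destruct (is_derive_limit (fun n => low g (pre s n)) (fun n => dlow g (pre s n))
  (fun t => F t s) (fun n => K * C / (1 - m) * m ^ n)) as (l & Dl & Bl).
- replace (Finite 0) with (Rbar_mult (K * C / (1 - m)) 0) by (simpl; f_equal; ring).
  apply is_lim_seq_scal_l, is_lim_seq_geom; rewrite Rabs_pos_eq; lra.
- intros n; apply Rmult_le_pos; [exact HKC|left; apply pow_lt; lra].
- generalize (filter_and _ _ Hu HF); apply filter_imp; intros t [Ut Ft].
  assert (H := proj1 (proj1 Ut)).
  split; [intros n; apply is_derive_low, Ut|split].
  + apply (telescope_bound (fun n => dlow g (pre s n) t)); [apply Rmult_le_pos; lra|exact Hm|].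
    intros n; simpl pre; eapply Rle_trans; [apply (dlow_step g r K); auto|].
    rewrite length_pre, Rmult_assoc; apply Rmult_le_compat_l; [exact HK|apply Hlin].
  + apply (is_lim_seq_le_le (fun n => F t s - (1 - r) ^ n) _ (fun _ => F t s)).
    * intros n.
      destruct (solution_within g t (F t) (pre s n) s H Ft (pre_bounds s n Hs)) as [A B].
      pose proof (mass_app_bounds g r K t (pre s n) nil Hr Ut) as [_ D].
      rewrite app_nil_r, length_pre in D; simpl mass in D at 2.
      lra.
    * replace (F t s) with (F t s - 0) at 1 by ring.
      apply is_lim_seq_minus'; [apply is_lim_seq_const|].
      apply is_lim_seq_geom; rewrite Rabs_pos_eq; lra.
    * apply is_lim_seq_const.
- unfold f1; rewrite (is_derive_unique _ _ _ Dl); split; [exact Dl|].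
  simpl in Bl; rewrite Rminus_0_r, Rmult_1_r in Bl; exact Bl.
Qed.

Lemma rel_odds_bounds (g : curve) (r K t : R) (w : list bool) :
  0 < r -> uniform g r K t -> r ^ 2 <= rel_odds g w t <= / r ^ 2.
Proof.
intros Hr Hu; assert (H := proj1 (proj1 Hu)).
assert (B : forall w, r <= odds g w t <= / r).
{ intros u; destruct (proj2 Hu u) as [[P1 P2] _]; pose proof (odds_pos g u t H).
  unfold prob in P1, P2; apply Rle_div_r in P1; [|lra]; apply Rle_div_l in P2; [|lra].
  split; [nra|].
  apply Rmult_le_reg_r with r; [exact Hr|]; rewrite Rinv_l by lra; nra. }
destruct (B w) as [W1 W2], (B nil) as [N1 N2]; unfold rel_odds.
assert (r <= / odds g nil t <= / r).
{ split; [rewrite <- (Rinv_inv r)|]; apply Rinv_le_contravar; lra. }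
assert (0 < / r) by (apply Rinv_0_lt_compat; lra).
split; unfold Rdiv.
- replace (r ^ 2) with (r * r) by ring; apply Rmult_le_compat; lra.
- replace (/ r ^ 2) with (/ r * / r) by (field; lra); apply Rmult_le_compat; lra.
Qed.

(** The odds of [psi v z] are v times the odds of z, so [psi] is logistic in log v; this is the
    origin of the factor psi (1 - psi). *)
Lemma is_derive_psi (v z : R -> R) (dv dz : R) :
  0 < v 0 -> 0 <= z 0 <= 1 -> is_derive v 0 (dv * v 0) -> is_derive z 0 dz ->
  is_derive (fun t => psi (v t) (z t)) 0
    (dv * (psi (v 0) (z 0) * (1 - psi (v 0) (z 0)))
      + v 0 / (1 + (v 0 - 1) * z 0) ^ 2 * dz).
Proof.
intros Hv Hz Dv Dz; pose proof (psi_den _ _ Hv Hz) as Hd.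
unfold psi; auto_derive.
- repeat split; try (eexists; eassumption); lra.
- change (Derive (fun x => v x) 0) with (Derive v 0).
  change (Derive (fun x => z x) 0) with (Derive z 0).
  rewrite (is_derive_unique _ _ _ Dv), (is_derive_unique _ _ _ Dz).
  field; lra.
Qed.

(* [mass] and [lder] describe F and f1 on dyadic intervals exactly, and inside
   such an interval f1 deviates from [lder] times F by a multiple of the mass. *)
Record estimates (g : curve) (F : R -> R -> R) (r K C : R) : Prop := {
  est_r : 0 < r < 1;
  est_C : 0 < C;
  est_uniform : uniform g r K 0;
  est_solution : de_Rham_solution g 0 (F 0);
  est_mass : forall w, f1 F (left w + width w) - f1 F (left w) = lder g w 0 * mass g w 0;
  est_cyl : forall w u v,
    left w <= u <= left w + width w -> left w <= v <= left w + width w ->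
    Rabs (f1 F v - f1 F u - lder g w 0 * (F 0 v - F 0 u)) <= C * mass g w 0
}.

(** Differentiate [solution_cylinder] in t. The derivative of the mass produces [lder] times F -
    [low]; what remains is the mass times the derivative of [psi], bounded independently of the
    word. *)
Lemma estimates_exist (g : curve) (F : R -> R -> R) :
  locally 0 (regular g) ->
  continuous (Derive (b1 g)) 0 -> continuous (Derive (c0 g)) 0 ->
  continuous (Derive (c1 g)) 0 ->
  locally 0 (fun t => de_Rham_solution g t (F t)) ->
  exists r K C, estimates g F r K C.
Proof.
intros Hreg Hb H0 H1 HF.
destruct (locally_uniform g Hreg Hb H0 H1) as (r & K & Hr & HK & Hu).
destruct (is_derive_solution g F r K Hr (Rlt_le _ _ HK) Hu HF) as (M & HM).
pose proof (locally_singleton _ _ Hu) as U0; pose proof (locally_singleton _ _ HF) as F0.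
pose proof (uniform_r g r K 0 U0) as Hr1.
assert (H := proj1 (proj1 U0)).
pose (B := / r ^ 2 / (r ^ 2) ^ 2).
assert (HB : 0 < B).
{ apply Rdiv_lt_0_compat; [apply Rinv_0_lt_compat|apply pow_lt]; apply pow_lt; lra. }
assert (M0 : 0 <= M).
{ destruct (HM 0 ltac:(lra)) as [_ A]; pose proof (Rabs_pos (f1 F 0)); lra. }
(* 2K bounds the difference of two values of [kap], the logarithmic derivative of [rel_odds]; [B]
   bounds the z-derivative of [psi], and [M] bounds f1. *)
pose (C := 2 * K + B * M).
assert (HC : 0 < C) by (unfold C; nra).
assert (Cyl : forall w s, 0 <= s <= 1 ->
  exists e, Rabs e <= C /\ f1 F (left w + s * width w) = dlow g w 0
    + lder g w 0 * (F 0 (left w + s * width w) - low g w 0) + mass g w 0 * e).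
{ intros w s Hs; destruct (HM s Hs) as [Ds Bs].
  assert (Dv : is_derive (rel_odds g w) 0
    ((kap g w 0 - kap g nil 0) * rel_odds g w 0)).
  { pose proof (is_derive_odds g w 0 (proj1 U0)) as D1.
    pose proof (is_derive_odds g nil 0 (proj1 U0)) as D2.
    pose proof (odds_pos g nil 0 H).
    replace ((kap g w 0 - kap g nil 0) * rel_odds g w 0) with
      ((kap g w 0 * odds g w 0 * odds g nil 0 - odds g w 0 * (kap g nil 0 * odds g nil 0))
        / odds g nil 0 ^ 2) by (unfold rel_odds; field; lra).
    apply (is_derive_div (odds g w) (odds g nil)); [exact D1|exact D2|lra]. }
  assert (Hz : 0 <= F 0 s <= 1) by (apply F0, Hs).
  pose proof (rel_odds_pos g w 0 H) as Hv.
  pose proof (is_derive_psi _ (fun t => F t s) _ _ Hv Hz Dv Ds) as Dp; cbv beta in Dp.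
  set (p := psi (rel_odds g w 0) (F 0 s)) in *.
  set (y := rel_odds g w 0 / (1 + (rel_odds g w 0 - 1) * F 0 s) ^ 2) in *.
  exists ((kap g w 0 - kap g nil 0) * (p * (1 - p)) + y * f1 F s); split.
  - assert (Hp : 0 <= p <= 1) by (apply psi_bounds; auto).
    apply Rabs_add_bound; rewrite Rabs_mult.
    + assert (Rabs (kap g w 0 - kap g nil 0) <= 2 * K).
      { destruct (proj2 U0 w) as [_ A1], (proj2 U0 nil) as [_ A2].
        rewrite <- Rabs_Ropp in A2; pose proof (Rabs_add_bound _ _ _ _ A1 A2) as A.
        replace (2 * K) with (K + K) by ring; exact A. }
      pose proof (Rabs_pos (kap g w 0 - kap g nil 0)).
      rewrite (Rabs_pos_eq (p * (1 - p))) by nra.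
      assert (p * (1 - p) <= 1) by nra.
      nra.
    + assert (Hy : Rabs y <= B).
      { destruct (rel_odds_bounds g r K 0 w Hr U0) as [V1 V2].
        (* The right side is a convex combination of 1 and [rel_odds]. *)
        assert (Hd : r ^ 2 <= 1 + (rel_odds g w 0 - 1) * F 0 s).
        { assert (r ^ 2 <= 1) by (simpl; nra).
          destruct (Rle_dec (rel_odds g w 0) 1); nra. }
        assert (Hr2 : 0 < r ^ 2) by (apply pow_lt; lra).
        rewrite Rabs_pos_eq.
        - unfold y, B, Rdiv; apply Rmult_le_compat; [lra| |lra|].
          + left; apply Rinv_0_lt_compat, pow_lt; lra.
          + apply Rinv_le_contravar; [apply pow_lt; lra|apply pow_incr; lra].
        - left; apply Rdiv_lt_0_compat; [lra|apply pow_lt; lra]. }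
      apply Rmult_le_compat; auto; apply Rabs_pos.
  - apply is_derive_unique.
    apply (is_derive_ext_loc (fun t => low g w t + mass g w t * psi (rel_odds g w t) (F t s))).
    { generalize (filter_and _ _ Hu HF); apply filter_imp; intros t [Ut Ft].
      symmetry; apply (solution_cylinder g t (F t)); auto; apply Ut. }
    rewrite (solution_cylinder g 0 (F 0) H F0) by exact Hs; fold p.
    set (e := _ + y * _) in *.
    replace (dlow g w 0 + lder g w 0 * (low g w 0 + mass g w 0 * p - low g w 0) + mass g w 0 * e)
      with (dlow g w 0 + (lder g w 0 * mass g w 0 * p + mass g w 0 * e)) by ring.
    apply (is_derive_plus (low g w)); [apply is_derive_low, U0|].
    apply (is_derive_mult (mass g w) (fun t => psi (rel_odds g w t) (F t s)));
      [apply is_derive_mass, U0|exact Dp|apply Rmult_comm]. }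
(* The factor 2 arises because [est_cyl] compares two points, each with an error of C times the
   mass. *)
exists r, K, (2 * C); split; auto; try lra.
- intros w.
  assert (E1 : f1 F (left w) = dlow g w 0).
  { apply is_derive_unique; apply (is_derive_ext_loc (low g w)); [|apply is_derive_low, U0].
    generalize (filter_and _ _ Hu HF); apply filter_imp; intros t [Ut Ft].
    symmetry; apply (solution_left g t (F t)); auto; apply Ut. }
  assert (E2 : f1 F (left w + width w) = dlow g w 0 + lder g w 0 * mass g w 0).
  { apply is_derive_unique; apply (is_derive_ext_loc (fun t => low g w t + mass g w t)).
    - generalize (filter_and _ _ Hu HF); apply filter_imp; intros t [Ut Ft].
      symmetry; apply (solution_right g t (F t)); auto; apply Ut.
    - apply (is_derive_plus (low g w)); [apply is_derive_low, U0|apply is_derive_mass, U0]. }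
  rewrite E1, E2; ring.
- intros w u v Hu' Hv'; pose proof (width_pos w) as Hw.
  assert (S : forall x, left w <= x <= left w + width w -> exists s, 0 <= s <= 1
    /\ x = left w + s * width w).
  { intros x Hx; exists ((x - left w) / width w); split; [|field; lra].
    split; [apply Rle_div_r; lra|apply Rle_div_l; lra]. }
  destruct (S u Hu') as (s & Hs & Es), (S v Hv') as (s' & Hs' & Es').
  destruct (Cyl w s Hs) as (e & He & Ee), (Cyl w s' Hs') as (e' & He' & Ee').
  rewrite <- Es in Ee; rewrite <- Es' in Ee'; rewrite Ee, Ee'.
  match goal with |- Rabs ?x <= _ => replace x with (mass g w 0 * (e' + - e)) by ring end.
  pose proof (mass_pos g w 0 H).
  rewrite Rabs_mult, Rabs_pos_eq, Rmult_comm by lra.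
  apply Rmult_le_compat_r; [lra|].
  rewrite <- Rabs_Ropp in He; pose proof (Rabs_add_bound _ _ _ _ He' He); lra.
Qed.

(** * Averages over pairs of sibling intervals *)

Definition mid (w : list bool) : R := left w + width w / 2.

Lemma right_ones (e : nat) (w : list bool) :
  left (repeat true e ++ w) + width (repeat true e ++ w) = left w + width w.
Proof.
induction e as [|e IH]; [reflexivity|].
change (repeat true (S e) ++ w) with (true :: (repeat true e ++ w)).
rewrite left_true, width_cons; lra.
Qed.

Lemma left_zeros (j : nat) (w : list bool) : left (repeat false j ++ w) = left w.
Proof. induction j; simpl; auto. Qed.

Lemma width_app (u w : list bool) : width (u ++ w) = width w / 2 ^ length u.
Proof.
unfold width; rewrite length_app, pow_add.
field; split; apply pow_nonzero; lra.
Qed.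

Lemma pow_small (l r : R) : 0 < l < 1 -> 0 < r < 1 ->
  exists k, (1 <= k)%nat /\ l ^ k <= r.
Proof.
intros Hl Hr.
destruct (pow_lt_1_zero l ltac:(rewrite Rabs_pos_eq; lra) r (proj1 Hr)) as [N HN].
exists (S N); split; [lia|].
specialize (HN (S N) ltac:(lia)).
rewrite Rabs_pos_eq in HN by (apply pow_le; lra); lra.
Qed.

Lemma linear_geometric_bound (l : R) : 0 < l < 1 ->
  exists C, 0 < C /\ forall n, (INR n + 1) * l ^ n <= C.
Proof.
intros Hl; destruct (geometric_dominates_linear l Hl) as (C & m & HC & Hm & H).
exists C; split; [exact HC|]; intros n; eapply Rle_trans; [apply H|].
rewrite <- (Rmult_1_r C) at 2; apply Rmult_le_compat_l; [lra|].
rewrite <- (pow1 n); apply pow_incr; lra.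
Qed.

Section Cylinders.

Variables (g : curve) (F : R -> R -> R) (r K C : R).
Hypothesis Hest : estimates g F r K C.

Let Hr := est_r _ _ _ _ _ Hest.
Let HC := est_C _ _ _ _ _ Hest.
Let Hu := est_uniform _ _ _ _ _ Hest.
Let Hs := est_solution _ _ _ _ _ Hest.
Let Hcore := proj1 (proj1 Hu).

Lemma est_K : 0 <= K.
Proof. destruct (proj2 Hu nil) as [_ A]; pose proof (Rabs_pos (kap g nil 0)); lra. Qed.

Lemma mass_cons_ge (i : bool) (w : list bool) : r * mass g w 0 <= mass g (i :: w) 0.
Proof.
pose proof (mass_app_bounds g r K 0 (i :: nil) w (proj1 Hr) Hu) as [A _].
simpl in A; rewrite Rmult_1_r in A; exact A.
Qed.

Lemma mass_cons_le (i : bool) (w : list bool) : mass g (i :: w) 0 <= mass g w 0.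
Proof.
pose proof (mass_split g w 0).
pose proof (mass_pos g (false :: w) 0 Hcore); pose proof (mass_pos g (true :: w) 0 Hcore).
destruct i; lra.
Qed.

(** The piece from x to the right end lies in [v] and contains its right half, so its mass is
    comparable to that of [v]. [right_piece] is the mirror image. *)
Lemma left_piece (v : list bool) (x : R) : left v <= x <= mid v ->
  let c := left v + width v in
  r * mass g v 0 <= F 0 c - F 0 x <= mass g v 0 /\
  Rabs (f1 F c - f1 F x - lder g v 0 * (F 0 c - F 0 x)) <= C * mass g v 0.
Proof.
intros Hx c; pose proof (width_pos v); unfold mid in Hx.
split; [|apply (est_cyl _ _ _ _ _ Hest); unfold c; lra].
pose proof (solution_right g 0 (F 0) v Hcore Hs).
destruct (solution_within g 0 (F 0) (false :: v) x Hcore Hs) as [A1 A2].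
{ rewrite width_cons; simpl left; lra. }
pose proof (mass_split g v 0); pose proof (mass_cons_ge true v).
simpl low in A1, A2; unfold c; lra.
Qed.

Lemma right_piece (v : list bool) (u : R) : mid v <= u <= left v + width v ->
  r * mass g v 0 <= F 0 u - F 0 (left v) <= mass g v 0 /\
  Rabs (f1 F u - f1 F (left v) - lder g v 0 * (F 0 u - F 0 (left v))) <= C * mass g v 0.
Proof.
intros Hx; pose proof (width_pos v); unfold mid in Hx.
split; [|apply (est_cyl _ _ _ _ _ Hest); lra].
pose proof (solution_left g 0 (F 0) v Hcore Hs).
destruct (solution_within g 0 (F 0) (true :: v) u Hcore Hs) as [A1 A2].
{ rewrite width_cons, left_true; lra. }
pose proof (mass_split g v 0); pose proof (mass_cons_ge false v).
assert (E : low g (true :: v) 0 = low g v 0 + mass g (false :: v) 0) by reflexivity.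
lra.
Qed.

Lemma Delta1F_right_end (v : list bool) (x : R) : left v <= x <= mid v ->
  Rabs (Delta1F F x (left v + width v) - lder g v 0) <= C / r.
Proof.
intros Hx; destruct (left_piece v x Hx) as [HA HN].
pose proof (mass_pos g v 0 Hcore).
set (c := left v + width v) in *; set (A := F 0 c - F 0 x) in *.
assert (0 < r * mass g v 0) by nra.
assert (HA0 : 0 < A) by lra.
replace (Delta1F F x c - lder g v 0) with
  ((f1 F c - f1 F x - lder g v 0 * A) / A) by (unfold Delta1F, A in *; field; lra).
unfold Rdiv; rewrite Rabs_mult, Rabs_inv, (Rabs_pos_eq A) by lra.
apply Rle_div_l; [lra|].
eapply Rle_trans; [exact HN|].
replace (C * / r * A) with (C * (A / r)) by (field; lra).
apply Rmult_le_compat_l; [lra|]; apply Rle_div_r; lra.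
Qed.

Lemma dyadic_scale (h d : R) : 0 < h <= d -> exists j, d / 2 ^ S j <= h <= d / 2 ^ j.
Proof.
intros Hh.
destruct (pow_lt_1_zero (/ 2) ltac:(rewrite Rabs_pos_eq; lra) (h / d)) as [N HN].
{ apply Rdiv_lt_0_compat; lra. }
specialize (HN N (Nat.le_refl N)).
rewrite Rabs_pos_eq in HN by (apply pow_le; lra).
assert (HN' : d / 2 ^ N < h).
{ unfold Rdiv; rewrite <- pow_inv; apply Rlt_div_r in HN; lra. }
clear HN; induction N as [|N IH].
- exfalso; simpl in HN'; lra.
- destruct (Rlt_le_dec (d / 2 ^ N) h) as [Hlt|Hle]; [apply IH, Hlt|].
  exists N; lra.
Qed.

(** Cutting at c exhibits the quotient as an average of the quotients on both sides, weighted by the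
    increments of F. *)
Lemma Delta1F_split (x c u : R) : F 0 u <> F 0 x ->
  Delta1F F x u =
  ((f1 F c - f1 F x) + (f1 F u - f1 F c)) / ((F 0 c - F 0 x) + (F 0 u - F 0 c)).
Proof. intros H; unfold Delta1F; field; split; lra. Qed.

(* The right piece carries at most the mass (1-r)^j of w while the left piece
   carries at least r^(e+2): a depth j much larger than e is compensated by the
   small weight of the right piece in the average defining [Delta1F]. *)
Lemma Delta1F_cylinder : exists C', 0 < C' /\
  forall (w : list bool) (e : nat) (x u : R),
  left (repeat true e ++ false :: w) <= x <= mid (repeat true e ++ false :: w) ->
  mid w < u <= left w + width w ->
  Rabs (Delta1F F x u - lder g w 0) <= C' * (1 + INR e).
Proof.
(* [k] levels on the right shrink the mass at least as much as the worst case of one level on the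
   left. *)
destruct (pow_small (1 - r) r ltac:(lra) Hr) as (k & _ & Hk).
destruct (linear_geometric_bound (1 - r) ltac:(lra)) as (C1 & HC1 & Hlin).
pose proof est_K as HK.
(* C/r collects the errors of [est_cyl] on both pieces. The rest pays for the change of [lder], at
   most K(e+1) on the left piece and K(j+1) on the right one. *)
exists (C / r + K * (2 + INR k + C1 / r ^ 2)).
assert (P1 : 0 < C / r) by (apply Rdiv_lt_0_compat; lra).
assert (P2 : 0 < C1 / r ^ 2) by (apply Rdiv_lt_0_compat; [lra|apply pow_lt; lra]).
pose proof (pos_INR k) as Pk.
split; [nra|].
intros w e x u Hx Hxu; pose proof (pos_INR e) as Pe; pose proof (width_pos w) as Hw.
set (w2 := repeat true e ++ false :: w) in *.
destruct (left_piece w2 x Hx) as [HA HNA].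
assert (Ec : left w2 + width w2 = mid w).
{ unfold w2, mid; rewrite right_ones, width_cons; reflexivity. }
rewrite Ec in *; set (c := mid w) in *.
(* This [j] places u in the right half of the interval [w'] below, which starts at c, so that
   [right_piece] applies. *)
destruct (dyadic_scale (u - c) (width w / 2)) as (j & Hj).
{ unfold c, mid in *; lra. }
pose (w' := repeat false j ++ true :: w).
assert (Lw' : left w' = c) by (unfold w'; rewrite left_zeros, left_true; reflexivity).
assert (Ww' : width w' = width w / 2 / 2 ^ j).
{ unfold w'; rewrite width_app, repeat_length, width_cons; reflexivity. }
assert (Hj2 : width w / 2 / 2 ^ S j = width w' / 2).
{ rewrite Ww'; simpl; field; apply pow_nonzero; lra. }
destruct (right_piece w' u) as [HB HNB].
{ unfold mid; rewrite Lw'; rewrite Hj2 in Hj; rewrite <- Ww' in Hj; lra. }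
rewrite Lw' in *.
set (A := F 0 c - F 0 x) in *; set (B := F 0 u - F 0 c) in *.
pose proof (lder_app g r K 0 (repeat true e ++ false :: nil) w (proj1 Hr) Hu) as Z1.
pose proof (lder_app g r K 0 (repeat false j ++ true :: nil) w (proj1 Hr) Hu) as Z2.
rewrite <- app_assoc, length_app, repeat_length, plus_INR in Z1, Z2; simpl in Z1, Z2.
change (repeat true e ++ false :: w) with w2 in Z1.
change (repeat false j ++ true :: w) with w' in Z2.
pose proof (mass_app_bounds g r K 0 (repeat true e) (false :: w) (proj1 Hr) Hu) as [M1 _].
pose proof (mass_app_bounds g r K 0 (repeat false j) (true :: w) (proj1 Hr) Hu) as [_ M2].
fold w2 in M1; fold w' in M2; rewrite repeat_length in M1, M2.
pose proof (mass_pos g w2 0 Hcore) as Q1; pose proof (mass_pos g w' 0 Hcore) as Q2.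
pose proof (mass_pos g w 0 Hcore) as Q3.
pose proof (pow_lt r e (proj1 Hr)) as Pr.
assert (A1 : r ^ 2 * (r ^ e * mass g w 0) <= A).
{ pose proof (mass_cons_ge false w) as X.
  apply Rle_trans with (r * mass g w2 0); [|lra].
  replace (r ^ 2 * (r ^ e * mass g w 0)) with (r * (r ^ e * (r * mass g w 0))) by ring.
  apply Rmult_le_compat_l; [lra|].
  eapply Rle_trans; [|exact M1]; apply Rmult_le_compat_l; lra. }
assert (B1 : B <= (1 - r) ^ j * mass g w 0).
{ pose proof (mass_cons_le true w); pose proof (pow_lt (1 - r) j ltac:(lra)).
  eapply Rle_trans; [apply HB|]; eapply Rle_trans; [exact M2|].
  apply Rmult_le_compat_l; lra. }
assert (HA0 : 0 < A) by nra. assert (HB0 : 0 < B) by nra.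
(* Up to depth k e there is nothing to gain. Of a larger depth, k e levels already bring the mass
   down to the scale of the left piece, and the surplus i is damped by (1-r)^i. *)
assert (JB : INR j * B <= (INR k * INR e + C1 / r ^ 2) * (A + B)).
{ assert (X0 : 0 <= INR k * INR e) by nra.
  destruct (Nat.le_gt_cases j (k * e)) as [Hle|Hgt].
  - apply le_INR in Hle; rewrite mult_INR in Hle.
    apply Rle_trans with (INR k * INR e * (A + B)); [|nra].
    apply Rmult_le_compat; try lra; apply pos_INR.
  - pose (i := (j - k * e)%nat).
    assert (Ej : j = (k * e + i)%nat) by (unfold i; lia).
    assert (X : INR i * B <= C1 / r ^ 2 * A).
    { apply Rle_trans with (INR i * ((1 - r) ^ i * (r ^ e * mass g w 0))).
      - apply Rmult_le_compat_l; [apply pos_INR|].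
        eapply Rle_trans; [exact B1|].
        rewrite Ej, pow_add, pow_mult.
        replace ((1 - r) ^ i * (r ^ e * mass g w 0)) with
          (r ^ e * ((1 - r) ^ i * mass g w 0)) by ring.
        rewrite Rmult_assoc; apply Rmult_le_compat_r.
        + apply Rmult_le_pos; [apply pow_le|]; lra.
        + apply pow_incr; split; [apply pow_le; lra|exact Hk].
      - assert (Y : INR i * (1 - r) ^ i <= C1).
        { pose proof (Hlin i); pose proof (pow_lt (1 - r) i ltac:(lra)); lra. }
        assert (Z : r ^ e * mass g w 0 <= A / r ^ 2).
        { apply (Rle_div_r (r ^ e * mass g w 0)); [apply pow_lt; lra|lra]. }
        replace (C1 / r ^ 2 * A) with (C1 * (A / r ^ 2)) by (field; lra).
        rewrite <- Rmult_assoc; apply Rmult_le_compat; try lra.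
        + apply Rmult_le_pos; [apply pos_INR|apply pow_le; lra].
        + nra. }
    rewrite Ej, plus_INR, mult_INR; nra. }
rewrite (Delta1F_split x c u) by (unfold A, B in *; lra); fold A B.
set (n1 := f1 F c - f1 F x) in *; set (n2 := f1 F u - f1 F c) in *.
replace ((n1 + n2) / (A + B) - lder g w 0) with
  ((n1 + n2 - lder g w 0 * (A + B)) / (A + B)) by (field; lra).
unfold Rdiv at 1; rewrite Rabs_mult, Rabs_inv, (Rabs_pos_eq (A + B)) by lra.
apply Rle_div_l; [lra|].
replace (n1 + n2 - lder g w 0 * (A + B)) with
  ((n1 - lder g w2 0 * A) + ((n2 - lder g w' 0 * B)
    + ((lder g w2 0 - lder g w 0) * A + (lder g w' 0 - lder g w 0) * B))) by ring.
assert (S1 : Rabs ((lder g w2 0 - lder g w 0) * A) <= K * (INR e + 1) * A).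
{ rewrite Rabs_mult, (Rabs_pos_eq A) by lra; apply Rmult_le_compat_r; lra. }
assert (S2 : Rabs ((lder g w' 0 - lder g w 0) * B) <= K * (INR j + 1) * B).
{ rewrite Rabs_mult, (Rabs_pos_eq B) by lra; apply Rmult_le_compat_r; lra. }
pose proof (Rabs_add_bound _ _ _ _ HNA (Rabs_add_bound _ _ _ _ HNB
  (Rabs_add_bound _ _ _ _ S1 S2))) as S.
eapply Rle_trans; [exact S|].
assert (T1 : C * mass g w2 0 <= C / r * A).
{ replace (C / r * A) with (C * (A / r)) by (field; lra).
  apply Rmult_le_compat_l; [lra|]; apply Rle_div_r; lra. }
assert (T2 : C * mass g w' 0 <= C / r * B).
{ replace (C / r * B) with (C * (B / r)) by (field; lra).
  apply Rmult_le_compat_l; [lra|]; apply Rle_div_r; lra. }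
assert (T3 : K * (INR j * B) <= K * ((INR k * INR e + C1 / r ^ 2) * (A + B))).
{ apply Rmult_le_compat_l; lra. }
apply Rle_trans with ((C / r + K * (INR e + 2) + K * (INR k * INR e + C1 / r ^ 2)) * (A + B)).
- assert (0 <= K * INR e * B) by (apply Rmult_le_pos; [apply Rmult_le_pos|]; lra).
  assert (0 <= K * A) by nra. assert (0 <= K * B) by nra.
  nra.
- apply Rmult_le_compat_r; [lra|].
  set (y := C1 / r ^ 2) in *.
  assert (0 <= C / r * INR e) by (apply Rmult_le_pos; lra).
  assert (0 <= K * INR k) by (apply Rmult_le_pos; lra).
  assert (0 <= K * INR e) by (apply Rmult_le_pos; lra).
  assert (0 <= K * y * INR e) by (apply Rmult_le_pos; [apply Rmult_le_pos|]; lra).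
  nra.
Qed.

(** Every digit 0 adds (1-p) [kap], and every digit 1 subtracts p [kap], where p and 1-p are at
    least r; the common rate r eps is the threshold for L in [limit_gap]. *)
Lemma lder_zeros (eps : R) (j : nat) (w : list bool) :
  0 <= eps -> (forall v, eps <= kap g v 0) ->
  lder g w 0 + r * eps * INR j <= lder g (repeat false j ++ w) 0.
Proof.
intros He Hk; induction j as [|j IH]; [simpl; lra|].
change (repeat false (S j) ++ w) with (false :: (repeat false j ++ w)).
rewrite S_INR; simpl lder.
destruct (proj2 Hu (repeat false j ++ w)) as [Hp _].
pose proof (Hk (repeat false j ++ w)).
assert (r * eps <= (1 - prob g (repeat false j ++ w) 0) * kap g (repeat false j ++ w) 0).
{ apply Rmult_le_compat; lra. }
lra.
Qed.

Lemma lder_ones (eps : R) (j : nat) (w : list bool) :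
  0 <= eps -> (forall v, eps <= kap g v 0) ->
  lder g (repeat true j ++ w) 0 <= lder g w 0 - r * eps * INR j.
Proof.
intros He Hk; induction j as [|j IH]; [simpl; lra|].
change (repeat true (S j) ++ w) with (true :: (repeat true j ++ w)).
rewrite S_INR; simpl lder.
destruct (proj2 Hu (repeat true j ++ w)) as [Hp _].
pose proof (Hk (repeat true j ++ w)).
assert (r * eps <= prob g (repeat true j ++ w) 0 * kap g (repeat true j ++ w) 0).
{ apply Rmult_le_compat; lra. }
lra.
Qed.

(* For j at most a small fraction of e, the right piece dominates the average. *)
Lemma Delta1F_lower (eps : R) : 0 <= eps -> (forall v, eps <= kap g v 0) ->
  exists k C', (1 <= k)%nat /\ 0 < C' /\
  forall (w : list bool) (e j : nat) (x : R), (k * j <= e)%nat ->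
  left (repeat true e ++ false :: w) <= x <= mid (repeat true e ++ false :: w) ->
  lder g w 0 + r * eps * INR j - C' <= Delta1F F x (mid w + width w / 2 / 2 ^ j).
Proof.
intros He Hk.
destruct (pow_small (1 - r) r ltac:(lra) Hr) as (k & Hk1 & Hkr).
destruct (linear_geometric_bound (1 - r) ltac:(lra)) as (C1 & HC1 & Hlin).
pose proof est_K as HK.
set (d := r * eps); assert (Hd : 0 <= d) by (unfold d; nra).
(* With [k] alone the left piece would only become comparable to the right one. The factor 2 leaves
   a surplus of at least e/2 levels, whose decay beats the weight e + 1. *)
exists (2 * k)%nat, (C / r + K + (K + d) * (2 * C1 / r)).
assert (P1 : 0 < C / r) by (apply Rdiv_lt_0_compat; lra).
assert (P2 : 0 < 2 * C1 / r) by (apply Rdiv_lt_0_compat; lra).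
split; [lia|split; [nra|]].
intros w e j x Hje Hx; pose proof (pos_INR e) as Pe; pose proof (width_pos w) as Hw.
set (w2 := repeat true e ++ false :: w) in *.
destruct (left_piece w2 x Hx) as [HA HNA].
assert (Ec : left w2 + width w2 = mid w).
{ unfold w2, mid; rewrite right_ones, width_cons; reflexivity. }
rewrite Ec in *; set (c := mid w) in *.
pose (w' := repeat false j ++ true :: w).
assert (Lw' : left w' = c) by (unfold w'; rewrite left_zeros, left_true; reflexivity).
assert (Ww' : width w' = width w / 2 / 2 ^ j).
{ unfold w'; rewrite width_app, repeat_length, width_cons; reflexivity. }
(* u is the right end of [w'], so the average over the right piece is exactly [lder] of [w']. *)
rewrite <- Ww'; set (u := c + width w').
pose proof (est_mass _ _ _ _ _ Hest w') as HNB; rewrite Lw' in HNB; fold u in HNB.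
pose proof (solution_left g 0 (F 0) w' Hcore Hs) as B1; rewrite Lw' in B1.
pose proof (solution_right g 0 (F 0) w' Hcore Hs) as B2; rewrite Lw' in B2; fold u in B2.
set (B := mass g w' 0) in *.
assert (EB : F 0 u - F 0 c = B) by lra.
set (A := F 0 c - F 0 x) in *.
pose proof (lder_app g r K 0 (repeat true e ++ false :: nil) w (proj1 Hr) Hu) as Z1.
rewrite <- app_assoc, length_app, repeat_length, plus_INR in Z1; simpl in Z1.
change (repeat true e ++ false :: w) with w2 in Z1.
pose proof (lder_zeros eps j (true :: w) He Hk) as Z2; fold w' in Z2; fold d in Z2.
pose proof (lder_step g r K 0 true w (proj1 Hr) Hu) as Z3.
pose proof (mass_app_bounds g r K 0 (repeat true e) (false :: w) (proj1 Hr) Hu) as [_ M1].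
pose proof (mass_app_bounds g r K 0 (repeat false j) (true :: w) (proj1 Hr) Hu) as [M2 _].
fold w2 in M1; fold w' in M2; fold B in M2; rewrite repeat_length in M1, M2.
pose proof (mass_pos g w2 0 Hcore) as Q1; pose proof (mass_pos g w' 0 Hcore) as Q2; fold B in Q2.
pose proof (mass_pos g w 0 Hcore) as Q3.
pose proof (pow_lt r j (proj1 Hr)) as Pr.
assert (A1 : A <= (1 - r) ^ e * mass g w 0).
{ pose proof (mass_cons_le false w); pose proof (pow_lt (1 - r) e ltac:(lra)).
  eapply Rle_trans; [apply HA|]; eapply Rle_trans; [exact M1|].
  apply Rmult_le_compat_l; lra. }
assert (B3 : r ^ j * mass g w 0 <= B / r).
{ apply (Rle_div_r (r ^ j * mass g w 0)); [lra|]; pose proof (mass_cons_ge true w).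
  eapply Rle_trans; [|exact M2]; rewrite Rmult_assoc.
  apply Rmult_le_compat_l; lra. }
assert (HA0 : 0 < A) by nra.
assert (AB : (INR e + 1) * A <= 2 * C1 / r * B).
{ pose (i := (e - k * j)%nat).
  assert (Ei : e = (k * j + i)%nat) by (unfold i; lia).
  assert (He2 : INR e + 1 <= 2 * (INR i + 1)).
  { assert (X : (e + 1 <= 2 * (i + 1))%nat) by lia.
    apply le_INR in X; rewrite mult_INR, !plus_INR in X; simpl in X; lra. }
  apply Rle_trans with (2 * (INR i + 1) * ((1 - r) ^ i * (r ^ j * mass g w 0))).
  - apply Rmult_le_compat; try lra.
    eapply Rle_trans; [exact A1|].
    rewrite Ei, pow_add, pow_mult.
    replace ((1 - r) ^ i * (r ^ j * mass g w 0)) with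
      (r ^ j * ((1 - r) ^ i * mass g w 0)) by ring.
    rewrite Rmult_assoc; apply Rmult_le_compat_r.
    + apply Rmult_le_pos; [apply pow_le|]; lra.
    + apply pow_incr; split; [apply pow_le; lra|exact Hkr].
  - pose proof (Hlin i) as Y.
    replace (2 * C1 / r * B) with (2 * (C1 * (B / r))) by (field; lra).
    rewrite <- Rmult_assoc, (Rmult_assoc 2), Rmult_assoc.
    apply Rmult_le_compat_l; [lra|].
    apply Rmult_le_compat; try lra.
    + apply Rmult_le_pos; [pose proof (pos_INR i); lra|apply pow_le; lra].
    + nra. }
rewrite (Delta1F_split x c u) by (unfold A in *; lra); fold A; rewrite EB.
set (n1 := f1 F c - f1 F x) in *; set (n2 := f1 F u - f1 F c) in *.
apply Rle_div_r; [lra|].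
assert (T1 : C * mass g w2 0 <= C / r * A).
{ replace (C / r * A) with (C * (A / r)) by (field; lra).
  apply Rmult_le_compat_l; [lra|]; apply Rle_div_r; lra. }
assert (N1 : (lder g w 0 - K * (INR e + 1) - C / r) * A <= n1).
{ assert (X : lder g w2 0 * A - C * mass g w2 0 <= n1).
  { apply Rabs_le_between in HNA; lra. }
  assert (Y : (lder g w 0 - K * (INR e + 1)) * A <= lder g w2 0 * A).
  { apply Rmult_le_compat_r; [lra|]; apply Rabs_le_between in Z1; lra. }
  lra. }
assert (N2 : (lder g w 0 - K + d * INR j) * B <= n2).
{ rewrite HNB; apply Rmult_le_compat_r; [lra|]; apply Rabs_le_between in Z3; lra. }
assert (Je : INR j <= INR e) by (apply le_INR; nia).
assert (T2 : d * INR j * A <= d * ((INR e + 1) * A)).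
{ rewrite Rmult_assoc; apply Rmult_le_compat_l; [lra|].
  apply Rmult_le_compat_r; lra. }
assert (T3 : (K + d) * ((INR e + 1) * A) <= (K + d) * (2 * C1 / r * B)).
{ apply Rmult_le_compat_l; lra. }
set (y := 2 * C1 / r) in *.
assert (0 <= (K + d) * y * A) by (apply Rmult_le_pos; [apply Rmult_le_pos|]; lra).
assert (0 <= C / r * B) by (apply Rmult_le_pos; lra).
assert (0 <= K * A) by (apply Rmult_le_pos; lra).
nra.
Qed.

End Cylinders.

Lemma log2_ge (n : nat) (h : R) : 0 < h <= / 2 ^ n -> INR n <= log2 (1 / h).
Proof.
intros Hh; unfold log2; pose proof (pow_lt 2 n ltac:(lra)) as Hp.
assert (L2 : 0 < ln 2) by (rewrite <- ln_1; apply ln_increasing; lra).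
apply Rle_div_r; [exact L2|].
rewrite <- ln_pow by lra; apply ln_le; [exact Hp|].
unfold Rdiv; rewrite Rmult_1_l, <- (Rinv_inv (2 ^ n)).
apply Rinv_le_contravar; lra.
Qed.

Lemma log2_le (n : nat) (h : R) : / 2 ^ n <= h -> log2 (1 / h) <= INR n.
Proof.
intros Hh; unfold log2; pose proof (pow_lt 2 n ltac:(lra)) as Hp.
pose proof (Rinv_0_lt_compat _ Hp) as Hi.
assert (L2 : 0 < ln 2) by (rewrite <- ln_1; apply ln_increasing; lra).
apply Rle_div_l; [exact L2|].
rewrite <- ln_pow by lra; apply ln_le; [apply Rdiv_lt_0_compat; lra|].
unfold Rdiv; rewrite Rmult_1_l, <- (Rinv_inv (2 ^ n)).
apply Rinv_le_contravar; lra.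
Qed.

(** * Condition (ND) and the dual curve *)

(** This identifies the maps G0 and G1 of (ND): they are the digit maps of the odds in the
    coordinate y = [rel_odds] - 1. *)
Lemma rel_odds_false (g : curve) (w : list bool) (t : R) :
  core (b1 g t) (c0 g t) (c1 g t) ->
  rel_odds g (false :: w) t - 1 = G0 g t (rel_odds g w t - 1).
Proof.
intros H; destruct (core_factors _ _ _ H) as (Hb & Hu & Hv & _).
pose proof (odds_pos g w t H) as Ho.
unfold rel_odds, G0; simpl odds; unfold factor0; field; lra.
Qed.

Lemma rel_odds_true (g : curve) (w : list bool) (t : R) :
  core (b1 g t) (c0 g t) (c1 g t) ->
  rel_odds g (true :: w) t - 1 = G1 g t (rel_odds g w t - 1).
Proof.
intros H; destruct (core_factors _ _ _ H) as (Hb & Hu & Hv & _).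
pose proof (odds_pos g w t H) as Ho.
unfold rel_odds, G1; simpl odds; unfold factor1; set (o := odds g w t) in *.
replace (b1 g t * (o / (b1 g t / (1 - b1 g t)) - 1) + 1)
  with ((1 - b1 g t) * (1 + o)) by (field; lra).
field; lra.
Qed.

Lemma convex_range (lo hi l x y : R) :
  0 <= l <= 1 -> lo <= x <= hi -> lo <= y <= hi -> lo <= l * x + (1 - l) * y <= hi.
Proof. intros; nra. Qed.

Lemma alpha_gt (g : curve) : core (b1 g 0) (c0 g 0) (c1 g 0) -> -1 < alpha g.
Proof.
intros H; destruct (core_factors _ _ _ H) as (Hb & Hu & Hv & Ha & _).
destruct H as (_ & [Hu1 _] & [Hv1 _]).
unfold alpha; repeat apply Rmin_glb_lt; [lra| |].
- apply Rlt_div_r; nra.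
- apply Rlt_div_r; lra.
Qed.

Lemma beta_ge0 (g : curve) : 0 <= beta g.
Proof. apply Rmax_l. Qed.

(* Both G0 and G1 move y towards their attracting fixed points. *)
Lemma rel_odds_range (g : curve) (w : list bool) :
  core (b1 g 0) (c0 g 0) (c1 g 0) ->
  alpha g <= rel_odds g w 0 - 1 <= beta g.
Proof.
intros H; destruct (core_factors _ _ _ H) as (Hb & Hu & Hv & Ha & _).
pose proof (alpha_gt g H) as Hal.
induction w as [|[|] w IH].
- unfold rel_odds; simpl odds.
  replace (b1 g 0 / (1 - b1 g 0) / (b1 g 0 / (1 - b1 g 0)) - 1) with 0 by (field; lra).
  split; [apply Rmin_l|apply Rmax_l].
- rewrite rel_odds_true by exact H; set (y := rel_odds g w 0 - 1) in *.
  assert (Hy : 0 < b1 g 0 * y + 1) by nra.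
  (* The weight of y is at most 1 because y > -1, which comes from [alpha_gt]. *)
  replace (G1 g 0 y) with ((1 - b1 g 0) / (b1 g 0 * y + 1) * y
    + (1 - (1 - b1 g 0) / (b1 g 0 * y + 1)) * (c1 g 0 / b1 g 0))
    by (unfold G1; field; lra).
  apply convex_range; [|exact IH|].
  + split; [apply Rle_div_r; lra|apply Rle_div_l; nra].
  + split.
    * eapply Rle_trans; [apply Rmin_r|apply Rmin_r].
    * eapply Rle_trans; [|apply Rmax_r]; apply Rmax_r.
- rewrite rel_odds_false by exact H; set (y := rel_odds g w 0 - 1) in *.
  replace (G0 g 0 y) with (b1 g 0 * (1 + c0 g 0) * y
    + (1 - b1 g 0 * (1 + c0 g 0)) * (c0 g 0 / (1 - b1 g 0 * (1 + c0 g 0))))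
    by (unfold G0; field; lra).
  apply convex_range; [nra|exact IH|].
  split.
  + eapply Rle_trans; [apply Rmin_r|apply Rmin_l].
  + eapply Rle_trans; [|apply Rmax_r]; apply Rmax_l.
Qed.

(** [dG0] and [dG1] are the partial t-derivatives of G0 and G1 at t = 0; [slope1] is the
    y-derivative of G1. *)
Definition dG0 (g : curve) (y : R) : R :=
  (Derive (b1 g) 0 * (1 + c0 g 0) + b1 g 0 * Derive (c0 g) 0) * y + Derive (c0 g) 0.

Definition dG1 (g : curve) (y : R) : R :=
  (((Derive (c1 g) 0 - Derive (b1 g) 0) * y + Derive (c1 g) 0) * (b1 g 0 * y + 1)
    - ((1 - b1 g 0 + c1 g 0) * y + c1 g 0) * (Derive (b1 g) 0 * y))
  / (b1 g 0 * y + 1) ^ 2.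

Definition slope1 (g : curve) (y : R) : R :=
  (1 - b1 g 0) * (1 + c1 g 0) / (b1 g 0 * y + 1) ^ 2.

Lemma Derive_slope1 (g : curve) (y : R) : 0 < b1 g 0 * y + 1 ->
  Derive (fun z => G1 g 0 z) y = slope1 g y.
Proof.
intros Hy; apply is_derive_unique; unfold G1, slope1; auto_derive; [lra|field; lra].
Qed.

Lemma drift_G0 (g : curve) (y : R) : regular g 0 ->
  drift (G0 g) y = dG0 g y / (1 - b1 g 0 * (1 + c0 g 0)).
Proof.
intros (_ & Db & D0 & D1); unfold drift; f_equal.
- apply is_derive_unique; unfold G0, dG0; auto_derive; [repeat split; auto|].
  change (Derive (fun x => b1 g x) 0) with (Derive (b1 g) 0).
  change (Derive (fun x => c0 g x) 0) with (Derive (c0 g) 0).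
  ring.
- f_equal; f_equal; apply is_derive_unique; unfold G0; auto_derive; trivial; ring.
Qed.

Lemma drift_G1 (g : curve) (y : R) : regular g 0 -> 0 < b1 g 0 * y + 1 ->
  drift (G1 g) y = dG1 g y / (1 - slope1 g y).
Proof.
intros (_ & Db & D0 & D1) Hy; unfold drift; rewrite Derive_slope1 by exact Hy; f_equal.
apply is_derive_unique; unfold G1, dG1; auto_derive; [repeat split; auto; lra|].
change (Derive (fun x => b1 g x) 0) with (Derive (b1 g) 0).
change (Derive (fun x => c1 g x) 0) with (Derive (c1 g) 0).
field; lra.
Qed.

(* The t-derivative at 0 of y = [rel_odds g w] - 1, whose iteration is governed
   by G0 and G1. *)
Definition dstate (g : curve) (w : list bool) : R :=
  (kap g w 0 - kap g nil 0) * rel_odds g w 0.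

(** The chain rule applied to [rel_odds_false], checked here as an identity of rational
    functions. *)
Lemma dstate_false (g : curve) (w : list bool) : core (b1 g 0) (c0 g 0) (c1 g 0) ->
  dstate g (false :: w) =
  dG0 g (rel_odds g w 0 - 1) + b1 g 0 * (1 + c0 g 0) * dstate g w.
Proof.
intros H; destruct (core_factors _ _ _ H) as (Hb & Hu & Hv & _).
pose proof (odds_pos g w 0 H) as Ho.
unfold dstate, dG0, rel_odds; simpl odds; simpl kap; unfold factor0, ldfactor0, prob.
field; lra.
Qed.

Lemma dstate_true (g : curve) (w : list bool) : core (b1 g 0) (c0 g 0) (c1 g 0) ->
  dstate g (true :: w) =
  dG1 g (rel_odds g w 0 - 1) + slope1 g (rel_odds g w 0 - 1) * dstate g w.
Proof.
intros H; destruct (core_factors _ _ _ H) as (Hb & Hu & Hv & _).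
pose proof (odds_pos g w 0 H) as Ho.
unfold dstate, dG1, slope1, rel_odds; simpl odds; simpl kap.
unfold factor1, ldfactor1, prob; set (o := odds g w 0) in *.
replace (b1 g 0 * (o / (b1 g 0 / (1 - b1 g 0)) - 1) + 1)
  with ((1 - b1 g 0) * (1 + o)) by (field; lra).
field; lra.
Qed.

(* The sign s = 1 or s = -1 serves the minima and the maxima of the drift. *)
Lemma kap_bound (g : curve) (s d : R) :
  regular g 0 -> slope_lt_1 g -> d <= 0 ->
  (forall y, alpha g <= y <= beta g -> d <= s * drift (G0 g) y) ->
  (forall y, alpha g <= y <= beta g -> d <= s * drift (G1 g) y) ->
  0 < s * Derive (b1 g) 0 * (alpha g + 1) + b1 g 0 * (1 - b1 g 0) * d ->
  exists e, 0 < e /\ forall w, e <= s * kap g w 0.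
Proof.
intros Hreg Hsl Hd H0 H1 HN; assert (H := proj1 Hreg).
destruct (core_factors _ _ _ H) as (Hb & Hu & Hv & Ha & _).
pose proof (alpha_gt g H) as Hal; pose proof (beta_ge0 g) as Hbe.
(* A lower bound d on the drift gives s dG >= d (1 - slope). Adding slope times the inductive bound
   gives d again, as the slopes are nonnegative. *)
assert (Z : forall w, d <= s * dstate g w).
{ intros w; induction w as [|[|] w IH].
  - unfold dstate; rewrite Rminus_diag, Rmult_0_l, Rmult_0_r; exact Hd.
  - rewrite dstate_true by exact H.
    pose proof (rel_odds_range g w H) as Hy; set (y := rel_odds g w 0 - 1) in *.
    assert (By : 0 < b1 g 0 * y + 1) by nra.
    specialize (H1 y Hy); specialize (Hsl y Hy).
    rewrite drift_G1 in H1 by auto; rewrite Derive_slope1 in Hsl by auto.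
    assert (P : 0 <= slope1 g y).
    { left; apply Rdiv_lt_0_compat; [nra|apply pow_lt; exact By]. }
    assert (Q : d * (1 - slope1 g y) <= s * dG1 g y).
    { replace (s * dG1 g y) with (s * (dG1 g y / (1 - slope1 g y)) * (1 - slope1 g y))
        by (field; lra).
      apply Rmult_le_compat_r; lra. }
    nra.
  - rewrite dstate_false by exact H.
    pose proof (rel_odds_range g w H) as Hy; set (y := rel_odds g w 0 - 1) in *.
    specialize (H0 y Hy); rewrite drift_G0 in H0 by auto.
    set (a := b1 g 0 * (1 + c0 g 0)) in *.
    assert (P : 0 <= a) by (unfold a; nra).
    assert (Q : d * (1 - a) <= s * dG0 g y).
    { replace (s * dG0 g y) with (s * (dG0 g y / (1 - a)) * (1 - a)) by (field; lra).
      apply Rmult_le_compat_r; lra. }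
    nra. }
set (n := s * Derive (b1 g) 0 * (alpha g + 1) + b1 g 0 * (1 - b1 g 0) * d) in *.
assert (Hbb : 0 < b1 g 0 * (1 - b1 g 0)) by nra.
(* Since d <= 0, the hypothesis forces this sign; it permits replacing alpha + 1 by any value of
   [rel_odds]. *)
assert (Hsb : 0 <= s * Derive (b1 g) 0).
{ apply Rmult_le_reg_r with (alpha g + 1); [lra|]; unfold n in HN; nra. }
exists (n / (b1 g 0 * (1 - b1 g 0) * (1 + beta g))); split.
- apply Rdiv_lt_0_compat; [exact HN|apply Rmult_lt_0_compat; lra].
- intros w; specialize (Z w); pose proof (rel_odds_range g w H) as Hy.
  pose proof (rel_odds_pos g w 0 H) as Hpos; set (v := rel_odds g w 0) in *.
  assert (E : s * kap g w 0 = (s * Derive (b1 g) 0 * v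
    + b1 g 0 * (1 - b1 g 0) * (s * dstate g w)) / (b1 g 0 * (1 - b1 g 0) * v)).
  { unfold dstate; fold v; simpl (kap g nil 0); field; lra. }
  rewrite E.
  assert (X : n <= s * Derive (b1 g) 0 * v + b1 g 0 * (1 - b1 g 0) * (s * dstate g w)).
  { unfold n; apply Rplus_le_compat; apply Rmult_le_compat_l; lra. }
  unfold Rdiv; apply Rmult_le_compat; [lra| |exact X|].
  + left; apply Rinv_0_lt_compat, Rmult_lt_0_compat; lra.
  + apply Rinv_le_contravar; [apply Rmult_lt_0_compat; lra|].
    apply Rmult_le_compat_l; lra.
Qed.

(** * The dual curve and the reflection of [0,1] *)

Lemma core_dual (b u v : R) : core b u v -> core (1 - b) (- (v / (1 + v))) (- (u / (1 + u))).
Proof.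
intros H; destruct (core_factors _ _ _ H) as (Hb & Hu & Hv & Ha & Hc & Hd).
destruct H as (_ & [Hu1 Hu2] & [Hv1 Hv2]).
unfold core.
replace (- (v / (1 + v))) with (1 / (1 + v) - 1) by (field; lra).
replace (- (u / (1 + u))) with (1 / (1 + u) - 1) by (field; lra).
replace (1 - (1 - b)) with b by ring.
assert (E1 : 1 - b < 1 / (1 + v)) by (apply Rlt_div_r; lra).
assert (E2 : 1 / (1 + v) < 1 / (1 - b)) by
  (unfold Rdiv; apply Rmult_lt_compat_l; [lra|apply Rinv_lt_contravar; nra]).
assert (E3 : b < 1 / (1 + u)) by (apply Rlt_div_r; lra).
assert (E4 : 1 / (1 + u) < 1 / b) by
  (unfold Rdiv; apply Rmult_lt_compat_l; [lra|apply Rinv_lt_contravar; nra]).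
assert (E5 : (1 - b) / b = 1 / b - 1) by (field; lra).
repeat split; lra.
Qed.

Lemma regular_dual (g : curve) (t : R) : regular g t -> regular (dual g) t.
Proof.
intros (H & Db & D0 & D1); destruct (core_factors _ _ _ H) as (Hb & Hu & Hv & _).
split; [apply core_dual, H|]; simpl.
repeat split; auto_derive; repeat split; auto; lra.
Qed.

(** The dual curve belongs to 1 - F(t,1-x): the reflection exchanges the digits and the two halves
    of every interval. *)
Lemma odds_dual (g : curve) (w : list bool) (t : R) :
  core (b1 g t) (c0 g t) (c1 g t) -> odds (dual g) (map negb w) t = / odds g w t.
Proof.
intros H; destruct (core_factors _ _ _ H) as (Hb & Hu & Hv & _).
induction w as [|[|] w IH]; simpl; [field; lra| |];
  pose proof (odds_pos g w t H); rewrite IH; unfold factor0, factor1; simpl.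
- replace (1 + - (c1 g t / (1 + c1 g t))) with (1 / (1 + c1 g t)) by (field; lra).
  field; lra.
- replace (1 + - (c0 g t / (1 + c0 g t))) with (1 / (1 + c0 g t)) by (field; lra).
  replace (1 - (1 - b1 g t)) with (b1 g t) by ring.
  field; lra.
Qed.

(** Inverting the odds negates their logarithmic derivative, so the maxima in the second alternative
    of (ND) also lead to a lower bound for [kap] of the original curve. *)
Lemma kap_dual (g : curve) (w : list bool) (t : R) :
  regular g t -> kap (dual g) (map negb w) t = - kap g w t.
Proof.
intros (H & Db & D0 & D1); destruct (core_factors _ _ _ H) as (Hb & Hu & Hv & _).
assert (Eb : Derive (b1 (dual g)) t = - Derive (b1 g) t).
{ apply is_derive_unique; simpl; auto_derive; [auto|].
  change (Derive (fun x => b1 g x) t) with (Derive (b1 g) t); ring. }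
assert (E0 : Derive (c0 (dual g)) t = - (Derive (c1 g) t / (1 + c1 g t) ^ 2)).
{ apply is_derive_unique; simpl; auto_derive; [repeat split; auto; lra|].
  change (Derive (fun x => c1 g x) t) with (Derive (c1 g) t); field; lra. }
assert (E1 : Derive (c1 (dual g)) t = - (Derive (c0 g) t / (1 + c0 g t) ^ 2)).
{ apply is_derive_unique; simpl; auto_derive; [repeat split; auto; lra|].
  change (Derive (fun x => c0 g x) t) with (Derive (c0 g) t); field; lra. }
assert (P : forall w, prob (dual g) (map negb w) t = 1 - prob g w t).
{ intros v; unfold prob; rewrite odds_dual by exact H.
  pose proof (odds_pos g v t H); field; lra. }
induction w as [|[|] w IH]; simpl map; simpl kap.
- simpl in Eb; rewrite Eb; field; lra.
- rewrite IH, P; unfold ldfactor0, ldfactor1; rewrite Eb, E0; simpl.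
  replace (1 + - (c1 g t / (1 + c1 g t))) with (1 / (1 + c1 g t)) by (field; lra).
  field; lra.
- rewrite IH, P; unfold ldfactor0, ldfactor1; rewrite Eb, E1; simpl.
  replace (1 + - (c0 g t / (1 + c0 g t))) with (1 / (1 + c0 g t)) by (field; lra).
  field; lra.
Qed.

Lemma ND_kap (g : curve) : regular g 0 -> ND g ->
  exists e, 0 < e /\ forall w, e <= kap g w 0.
Proof.
intros Hreg [[Hs (d0 & d1 & [_ M0] & [_ M1] & HN)]|[Hs (d0 & d1 & [_ M0] & [_ M1] & HN)]].
- pose proof (Rmin_l 0 (Rmin d0 d1)); pose proof (Rmin_r 0 (Rmin d0 d1)).
  pose proof (Rmin_l d0 d1); pose proof (Rmin_r d0 d1).
  destruct (kap_bound g 1 (Rmin 0 (Rmin d0 d1)) Hreg Hs) as (e & He & Hk); try lra.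
  + intros y Hy; specialize (M0 y Hy); lra.
  + intros y Hy; specialize (M1 y Hy); lra.
  + exists e; split; [exact He|]; intros w; specialize (Hk w); lra.
- pose proof (Rmax_l 0 (Rmax d0 d1)); pose proof (Rmax_r 0 (Rmax d0 d1)).
  pose proof (Rmax_l d0 d1); pose proof (Rmax_r d0 d1).
  destruct (kap_bound (dual g) (-1) (- Rmax 0 (Rmax d0 d1)) (regular_dual g 0 Hreg) Hs)
    as (e & He & Hk); try lra.
  + intros y Hy; specialize (M0 y Hy); lra.
  + intros y Hy; specialize (M1 y Hy); lra.
  + exists e; split; [exact He|]; intros w; specialize (Hk (map negb w)).
    rewrite kap_dual in Hk by exact Hreg; lra.
Qed.

(** * Binary digits and the limit *)

(** The formula for the left end decides the next digit of the bisection, and that digit advances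
    the formula; hence the joint statement. *)
Lemma floor_digit (x : R) (n : nat) : 0 <= x < 1 ->
  left (pre x n) = IZR (Zfloor (2 ^ n * x)) / 2 ^ n /\
  ((pre x (S n) = true :: pre x n /\ Zfloor (2 ^ S n * x) = (2 * Zfloor (2 ^ n * x) + 1)%Z) \/
   (pre x (S n) = false :: pre x n /\ Zfloor (2 ^ S n * x) = (2 * Zfloor (2 ^ n * x))%Z)).
Proof.
intros Hx.
assert (Step : forall n, left (pre x n) = IZR (Zfloor (2 ^ n * x)) / 2 ^ n ->
  ((pre x (S n) = true :: pre x n /\ Zfloor (2 ^ S n * x) = (2 * Zfloor (2 ^ n * x) + 1)%Z) \/
   (pre x (S n) = false :: pre x n /\ Zfloor (2 ^ S n * x) = (2 * Zfloor (2 ^ n * x))%Z))).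
{ clear n; intros n E; pose proof (Zfloor_bound (2 ^ n * x)) as B.
  pose proof (pow_lt 2 n ltac:(lra)) as P.
  set (N := Zfloor (2 ^ n * x)) in *; simpl pre; rewrite E, width_pre.
  destruct (Rle_lt_dec _ _) as [H|H]; [left|right]; (split; [reflexivity|]);
    apply Zfloor_eq; [rewrite plus_IZR|]; rewrite mult_IZR; simpl pow.
  - apply (Rmult_le_compat_l (2 ^ n)) in H; [|lra].
    replace (2 ^ n * (IZR N / 2 ^ n + / 2 ^ n / 2)) with (IZR N + 1 / 2) in H by (field; lra).
    lra.
  - apply (Rmult_lt_compat_l (2 ^ n)) in H; [|lra].
    replace (2 ^ n * (IZR N / 2 ^ n + / 2 ^ n / 2)) with (IZR N + 1 / 2) in H by (field; lra).
    lra. }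
assert (E : forall n, left (pre x n) = IZR (Zfloor (2 ^ n * x)) / 2 ^ n).
{ clear n; intros n; induction n as [|n IH].
  - simpl; rewrite Rmult_1_l, (Zfloor_eq 0) by lra; field.
  - pose proof (pow_lt 2 n ltac:(lra)).
    destruct (Step n IH) as [[-> ->]|[-> ->]].
    + rewrite left_true, IH, width_pre, plus_IZR, mult_IZR; simpl; field; lra.
    + simpl left; rewrite IH, mult_IZR; simpl; field; lra. }
split; [apply E|apply Step, E].
Qed.

Lemma trunc_left (x : R) (n : nat) : 0 <= x < 1 -> trunc n x = left (pre x n).
Proof.
intros Hx; unfold trunc; induction n as [|n IH].
- rewrite sum_n_m_zero by lia; reflexivity.
- rewrite sum_n_Sm, IH by lia; unfold plus; cbn -[pow INR pre left]; unfold digit.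
  pose proof (pow_lt 2 n ltac:(lra)).
  destruct (floor_digit x n Hx) as [_ [[-> ->]|[-> ->]]].
  + replace ((2 * Zfloor (2 ^ n * x) + 1) mod 2)%Z with 1%Z
      by (rewrite Z.add_comm, Z.mul_comm, Z.mod_add; [reflexivity|lia]).
    rewrite left_true, width_pre; simpl pow; field; lra.
  + replace ((2 * Zfloor (2 ^ n * x)) mod 2)%Z with 0%Z
      by (rewrite Z.mul_comm, Z.mod_mul; [reflexivity|lia]).
    simpl left; unfold Rdiv; ring.
Qed.

Lemma scaled_not_integer (x : R) (n : nat) (N : Z) : 0 < x < 1 -> ~ dyadic x ->
  2 ^ S n * x <> IZR N.
Proof.
intros Hx Hd E; apply Hd; exists (S n), (Z.to_nat N).
pose proof (pow_lt 2 (S n) ltac:(lra)) as P.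
assert (N0 : (0 < N)%Z) by (apply lt_IZR; rewrite <- E; nra).
assert (EN : INR (Z.to_nat N) = 2 ^ S n * x) by (rewrite INR_IZR_INZ, Z2Nat.id, E by lia; reflexivity).
assert (Lt : (Z.to_nat N < 2 ^ S n)%nat).
{ apply INR_lt; rewrite EN, pow_INR; change (INR 2) with 2; nra. }
split; [lia|split; [lia|]].
rewrite EN; field; lra.
Qed.

(** For non-dyadic x the scaled value is never an integer, so the floor of 2^(n+1) (1-x) is 2^(n+1)
    - 1 minus that of 2^(n+1) x. This flips every digit. *)
Lemma digit_complement (x : R) (n : nat) : 0 < x < 1 -> ~ dyadic x ->
  digit (S n) (1 - x) = 1%Z <-> pre x (S n) = false :: pre x n.
Proof.
intros Hx Hd; unfold digit.
assert (E : Zfloor (2 ^ S n * (1 - x)) = (2 * 2 ^ Z.of_nat n - 1 - Zfloor (2 ^ S n * x))%Z).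
{ apply Zfloor_eq; pose proof (Zfloor_bound (2 ^ S n * x)) as B.
  pose proof (scaled_not_integer x n (Zfloor (2 ^ S n * x)) Hx Hd).
  rewrite !minus_IZR, mult_IZR, <- pow_IZR; simpl pow in *; lra. }
rewrite E; clear E.
destruct (floor_digit x n ltac:(lra)) as [_ [[-> ->]|[-> ->]]].
- split; [|discriminate].
  replace (2 * 2 ^ Z.of_nat n - 1 - (2 * Zfloor (2 ^ n * x) + 1))%Z
    with ((2 ^ Z.of_nat n - 1 - Zfloor (2 ^ n * x)) * 2)%Z by ring.
  rewrite Z.mod_mul by lia; discriminate.
- split; [reflexivity|intros _].
  replace (2 * 2 ^ Z.of_nat n - 1 - 2 * Zfloor (2 ^ n * x))%Z
    with (1 + (2 ^ Z.of_nat n - 1 - Zfloor (2 ^ n * x)) * 2)%Z by ring.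
  rewrite Z.mod_add by lia; reflexivity.
Qed.

Lemma Z1_lder (g : curve) (F : R -> R -> R) (r K C x : R) (n : nat) :
  estimates g F r K C -> 0 <= x < 1 -> Z1 F n x = lder g (pre x n) 0.
Proof.
intros Hest Hx; unfold Z1, Delta1F; rewrite trunc_left by exact Hx.
pose proof (est_mass _ _ _ _ _ Hest (pre x n)) as E.
assert (Hc := proj1 (proj1 (est_uniform _ _ _ _ _ Hest))).
pose proof (solution_left g 0 (F 0) (pre x n) Hc (est_solution _ _ _ _ _ Hest)) as E1.
pose proof (solution_right g 0 (F 0) (pre x n) Hc (est_solution _ _ _ _ _ Hest)) as E2.
pose proof (mass_pos g (pre x n) 0 Hc).
rewrite width_pre in *; rewrite E1, E2.
set (p := f1 F (left (pre x n))) in *.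
set (q := f1 F (left (pre x n) + / 2 ^ n)) in *.
replace q with (p + lder g (pre x n) 0 * mass g (pre x n) 0) by lra.
field; lra.
Qed.

(** An upper bound of order o(a), in product form because [a] may vanish at 0. *)
Definition negligible (a s : nat -> R) : Prop :=
  forall eta, 0 < eta -> exists N, forall k, (N <= k)%nat -> s k <= eta * a k.

Lemma negligible_plus (a s s' : nat -> R) :
  negligible a s -> negligible a s' -> negligible a (fun k => s k + s' k).
Proof.
intros H H' eta He.
destruct (H (eta / 2) ltac:(lra)) as [N HN], (H' (eta / 2) ltac:(lra)) as [N' HN'].
exists (max N N'); intros k Hk; specialize (HN k ltac:(lia)); specialize (HN' k ltac:(lia)).
lra.
Qed.

Lemma negligible_scal (a s : nat -> R) (c : R) :
  0 < c -> negligible a s -> negligible a (fun k => c * s k).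
Proof.
intros Hc H eta He; destruct (H (eta / c)) as [N HN]; [apply Rdiv_lt_0_compat; lra|].
exists N; intros k Hk; specialize (HN k Hk).
replace (eta * a k) with (c * (eta / c * a k)) by (field; lra).
apply Rmult_le_compat_l; lra.
Qed.

Lemma negligible_le (a s s' : nat -> R) (N0 : nat) :
  (forall k, (N0 <= k)%nat -> s k <= s' k) -> negligible a s' -> negligible a s.
Proof.
intros Hle H eta He; destruct (H eta He) as [N HN].
exists (max N N0); intros k Hk.
eapply Rle_trans; [apply Hle; lia|apply HN; lia].
Qed.

Lemma negligible_const (a : nat -> R) (c : R) :
  (forall k, INR k <= a k + 1) -> negligible a (fun _ => c).
Proof.
intros Ha eta He; destruct (INR_unbounded (Rabs c / eta + 1)) as [N HN].
exists N; intros k Hk; apply le_INR in Hk; specialize (Ha k).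
apply Rle_trans with (Rabs c); [apply Rle_abs|].
replace (Rabs c) with (eta * (Rabs c / eta)) by (field; lra).
apply Rmult_le_compat_l; lra.
Qed.

(** * Asymptotics along the successive digits 0 of x *)

Section Asymptotics.

Variables (g : curve) (F : R -> R -> R) (r K C eps x : R) (m : nat -> nat).
Hypothesis Hest : estimates g F r K C.
Hypothesis Heps : 0 < eps.
Hypothesis Hkap : forall w, eps <= kap g w 0.
Hypothesis Hx : 0 < x < 1.
Hypothesis Hdy : ~ dyadic x.
Hypothesis Hm : enumerates_ones (1 - x) m.

(* [node k] is the dyadic interval around x that is split by the k-th digit 0 of
   x; its right half lies to the right of x, and [gap k] digits 1 follow. *)
Let pos (k : nat) : nat := (m (S k) - 1)%nat.
Let node (k : nat) : list bool := pre x (pos k).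
Let gap (k : nat) : nat := (m (S (S k)) - m (S k) - 1)%nat.
Let a (k : nat) : R := INR (pos k).
Let z (k : nat) : R := lder g (node k) 0.
Let right (k : nat) : R := left (node k) + width (node k).

Lemma zero_position (i : nat) :
  pre x (S i) = false :: pre x i <-> exists k, m (S k) = S i.
Proof.
rewrite <- digit_complement by assumption; destruct Hm as [_ Hi]; split.
- intros H; destruct (proj1 (Hi (S i)) (conj (le_n_S 0 i (Nat.le_0_l i)) H)) as ([|n] & Hn & E); [lia|].
  exists n; exact E.
- intros [k Hk]; apply (Hi (S i)); exists (S k); split; [lia|exact Hk].
Qed.

Lemma m_mono (j k : nat) : (j < k)%nat -> (m (S j) < m (S k))%nat.
Proof.
intros Hjk; induction Hjk as [|k Hjk IH]; [apply (proj1 Hm); lia|].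
pose proof (proj1 Hm (S k) ltac:(lia)); lia.
Qed.

Lemma m_pos (k : nat) : (1 <= m (S k))%nat.
Proof.
destruct (proj2 Hm (m (S k))) as [_ H]; apply H; exists (S k); split; [lia|reflexivity].
Qed.

Lemma pos_S (k : nat) : pos (S k) = (pos k + gap k + 1)%nat.
Proof.
unfold pos, gap; pose proof (m_mono k (S k) ltac:(lia)); pose proof (m_pos k); lia.
Qed.

Lemma pos_ge (k : nat) : (k <= pos k)%nat.
Proof. induction k as [|k IH]; [lia|rewrite pos_S; lia]. Qed.

Lemma a_ge (k : nat) : INR k <= a k + 1.
Proof. pose proof (le_INR _ _ (pos_ge k)); unfold a; lra. Qed.

Lemma pre_node (k : nat) : pre x (S (pos k)) = false :: node k.
Proof. apply zero_position; exists k; unfold pos; pose proof (m_pos k); lia. Qed.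

Lemma node_S (k : nat) : node (S k) = repeat true (gap k) ++ false :: node k.
Proof.
unfold node at 1; rewrite pos_S.
replace (pos k + gap k + 1)%nat with (gap k + S (pos k))%nat by lia.
rewrite <- pre_node.
assert (H : forall i, (i <= gap k)%nat ->
  pre x (i + S (pos k)) = repeat true i ++ pre x (S (pos k))); [|apply H; lia].
intros i; induction i as [|i IH]; intros Hi; [reflexivity|].
change (repeat true (S i)) with (true :: repeat true i).
rewrite <- app_comm_cons, <- IH by lia.
change (S i + S (pos k))%nat with (S (i + S (pos k))).
destruct (floor_digit x (i + S (pos k)) ltac:(lra)) as [_ [[E _]|[E _]]]; [exact E|exfalso].
apply zero_position in E; destruct E as [l El].
assert (Hk : (m (S k) < m (S l) < m (S (S k)))%nat).
{ unfold gap, pos in *; pose proof (m_mono k (S k) ltac:(lia)); pose proof (m_pos k); lia. }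
destruct (Nat.lt_trichotomy l k) as [Hl|[Hl|Hl]].
- pose proof (m_mono _ _ Hl); lia.
- subst l; lia.
- destruct (Nat.eq_dec l (S k)) as [->|]; [lia|].
  pose proof (m_mono (S k) l ltac:(lia)); lia.
Qed.

Lemma node_bounds (k : nat) : left (node k) <= x < mid (node k).
Proof.
pose proof (pre_bounds_strict x (S (pos k)) ltac:(lra)) as H.
rewrite pre_node, width_cons in H; exact H.
Qed.

(** The digits 1 after a digit 0 keep the right end fixed. Hence the intervals from [mid (node k)]
    to [right k] tile a right neighbourhood of x, and each x + h falls into one of them. *)
Lemma right_S (k : nat) : right (S k) = mid (node k).
Proof. unfold right; rewrite node_S, right_ones, width_cons; reflexivity. Qed.

Lemma width_node (k : nat) : width (node k) = / 2 ^ pos k.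
Proof. apply width_pre. Qed.


Lemma right_close (d : R) : 0 < d -> exists N, forall k, (N <= k)%nat -> right k - x < d.
Proof.
intros Hd.
destruct (pow_lt_1_zero (/ 2) ltac:(rewrite Rabs_pos_eq; lra) d Hd) as [N HN].
exists N; intros k Hk; pose proof (pos_ge k).
specialize (HN (pos k) ltac:(lia)); rewrite Rabs_pos_eq, pow_inv in HN by (apply pow_le; lra).
pose proof (node_bounds k); unfold right; rewrite width_node in *; lra.
Qed.

Lemma find_node (N : nat) (u : R) : x < u <= right N ->
  exists k, (N <= k)%nat /\ mid (node k) < u <= right k.
Proof.
intros Hu; destruct (right_close (u - x) ltac:(lra)) as [M HM].
specialize (HM (N + M)%nat ltac:(lia)).
assert (HM' : right (N + M) < u) by lra; clear HM.
induction M as [|M IH]; [rewrite Nat.add_0_r in HM'; lra|].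
destruct (Rlt_le_dec (right (N + M)) u) as [Hlt|Hle]; [apply IH, Hlt|].
exists (N + M)%nat; split; [lia|split; [|exact Hle]].
rewrite <- right_S, <- Nat.add_succ_r; exact HM'.
Qed.

Lemma average_upper : exists C', 0 < C' /\ forall k u, mid (node k) < u <= right k ->
  Rabs (Delta1F F x u - z k) <= C' * (1 + INR (gap k)) /\
  a k <= log2 (1 / (u - x)) <= a k + INR (gap k) + 2.
Proof.
destruct (Delta1F_cylinder g F r K C Hest) as (C' & HC & H).
exists C'; split; [exact HC|]; intros k u Hu.
pose proof (node_bounds k) as B; pose proof (node_bounds (S k)) as B'.
pose proof (right_S k) as Er; unfold right, mid in *.
split.
- apply H; [|exact Hu]; rewrite <- node_S; unfold mid; lra.
- pose proof (pow_lt 2 (pos (S k)) ltac:(lra)).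
  rewrite !width_node in *; split.
  + apply log2_ge; lra.
  (* x lies in the left half of [node (S k)], whose right end is [mid (node k)], so u - x is at
     least half the width of that node. *)
  + replace (a k + INR (gap k) + 2) with (INR (S (pos (S k))))
      by (rewrite S_INR, pos_S, !plus_INR; unfold a; simpl; ring).
    apply log2_le; simpl pow; rewrite Rinv_mult; lra.
Qed.

Lemma average_right (k : nat) :
  Rabs (Delta1F F x (right k) - z k) <= C / r /\
  a k <= log2 (1 / (right k - x)) <= a k + 1.
Proof.
pose proof (node_bounds k) as B; split.
- apply (Delta1F_right_end g F r K C Hest); lra.
- unfold right, mid in *; pose proof (pow_lt 2 (pos k) ltac:(lra)).
  rewrite width_node in *; split.
  + apply log2_ge; lra.
  + replace (a k + 1) with (INR (S (pos k))) by (rewrite S_INR; reflexivity).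
    apply log2_le; simpl pow; rewrite Rinv_mult; lra.
Qed.

Lemma average_lower : exists b C', (1 <= b)%nat /\ 0 < C' /\
  forall k j, (b * j <= gap k)%nat -> exists u, x < u <= right k /\
  z k + r * eps * INR j - C' <= Delta1F F x u /\
  a k + INR j <= log2 (1 / (u - x)) <= a k + INR j + 1.
Proof.
destruct (Delta1F_lower g F r K C Hest eps (Rlt_le _ _ Heps) Hkap)
  as (b & C' & Hb & HC & H).
exists b, C'; split; [exact Hb|split; [exact HC|]]; intros k j Hj.
exists (mid (node k) + width (node k) / 2 / 2 ^ j).
pose proof (node_bounds k) as B; pose proof (node_bounds (S k)) as B'.
pose proof (right_S k) as Er.
assert (J : width (node k) / 2 / 2 ^ j = / 2 ^ S (pos k + j)).
{ rewrite width_node; simpl pow; rewrite pow_add; field; split; apply pow_nonzero; lra. }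
(* From b >= 1 follows j <= gap k. Thus the distance from x to the midpoint is at most the offset
   added to it, and u - x is known up to a factor 2. *)
assert (P : / 2 ^ pos (S k) <= / 2 ^ S (pos k + j)).
{ apply Rinv_le_contravar; [apply pow_lt; lra|].
  apply Rle_pow; [lra|rewrite pos_S; nia]. }
assert (P' : / 2 ^ S (pos k + j) <= / 2 ^ S (pos k)).
{ apply Rinv_le_contravar; [apply pow_lt; lra|].
  apply Rle_pow; [lra|lia]. }
assert (P0 : 0 < / 2 ^ S (pos k + j)) by (apply Rinv_0_lt_compat, pow_lt; lra).
assert (Ph : / 2 ^ S (pos k) = / 2 ^ pos k / 2) by (simpl pow; rewrite Rinv_mult; field; apply pow_nonzero; lra).
assert (Pj : / 2 ^ S (pos k + j) = / 2 ^ (pos k + j) / 2)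
  by (simpl pow; rewrite Rinv_mult; field; apply pow_nonzero; lra).
split; [|split].
- rewrite J; unfold right, mid in *; rewrite !width_node in *; lra.
- apply (H _ (gap k)); [exact Hj|]; rewrite <- node_S; lra.
- rewrite J; unfold right, mid in *; rewrite !width_node in *.
  replace (a k + INR j) with (INR (pos k + j)) by (rewrite plus_INR; reflexivity).
  rewrite <- S_INR; split.
  + apply log2_ge; lra.
  + apply log2_le; lra.
Qed.

Lemma z_decrease (k : nat) : z (S k) <= z k + K - r * eps * INR (gap k).
Proof.
unfold z; rewrite node_S.
pose proof (lder_ones g F r K C Hest eps (gap k) (false :: node k) (Rlt_le _ _ Heps) Hkap).
pose proof (lder_step g r K 0 false (node k) (proj1 (est_r _ _ _ _ _ Hest))
  (est_uniform _ _ _ _ _ Hest)) as B.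
apply Rabs_le_between in B; lra.
Qed.

Lemma lder_pre_step (n i : nat) :
  Rabs (lder g (pre x (n + i)) 0 - lder g (pre x n) 0) <= K * INR i.
Proof.
induction i as [|i IH].
- rewrite Nat.add_0_r, Rminus_diag, Rabs_R0; simpl; lra.
- rewrite Nat.add_succ_r, S_INR; simpl pre.
  set (d := if Rle_lt_dec _ _ then true else false).
  pose proof (lder_step g r K 0 d (pre x (n + i)) (proj1 (est_r _ _ _ _ _ Hest))
    (est_uniform _ _ _ _ _ Hest)) as A.
  pose proof (Rabs_add_bound _ _ _ _ A IH) as B.
  replace (lder g (d :: pre x (n + i)) 0 - lder g (pre x n) 0) with
    (lder g (d :: pre x (n + i)) 0 - lder g (pre x (n + i)) 0
      + (lder g (pre x (n + i)) 0 - lder g (pre x n) 0)) by ring.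
  lra.
Qed.

Lemma Z1_node (k i : nat) :
  Rabs (Z1 F (pos k + i) x - z k) <= K * INR i.
Proof.
rewrite (Z1_lder g F r K C) by (auto; lra); apply lder_pre_step.
Qed.

Lemma gap_ratio :
  negligible a (fun k => INR (gap k)) <->
  is_lim_seq (fun n => INR (m (S n)) / INR (m n)) 1.
Proof.
assert (E : forall k, INR (m (S (S k))) / INR (m (S k)) - 1 = (INR (gap k) + 1) / (a k + 1)).
{ intros k; pose proof (m_mono k (S k) ltac:(lia)); pose proof (m_pos k) as Hp.
  pose proof (le_INR _ _ Hp) as Hp'; simpl in Hp'.
  unfold a, gap, pos; rewrite !minus_INR by lia; simpl; field; lra. }
rewrite is_lim_seq_incr_1; split.
- intros H; apply is_lim_seq_spec; intros e.
  assert (H' : negligible a (fun k => INR (gap k) + 1)).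
  { apply negligible_plus; [exact H|apply negligible_const, a_ge]. }
  destruct (H' (e / 2) ltac:(pose proof (cond_pos e); lra)) as [N HN].
  exists N; intros k Hk; specialize (HN k Hk); rewrite E.
  pose proof (pos_INR (gap k)); pose proof (pos_INR (pos k)) as P; fold (a k) in P.
  pose proof (cond_pos e).
  rewrite Rabs_pos_eq by (apply Rle_div_r; lra).
  apply Rlt_div_l; nra.
- intros H; apply is_lim_seq_spec in H; intros eta He.
  (* The cap at 1 lets gap + 1 < eta' (a + 1), with eta' = min(eta, 1), imply gap < eta' a. *)
  destruct (H (mkposreal (Rmin eta 1) ltac:(apply Rmin_glb_lt; lra))) as [N HN].
  exists N; intros k Hk; specialize (HN k Hk); simpl in HN; rewrite E in HN.
  pose proof (pos_INR (gap k)); pose proof (pos_INR (pos k)) as P; fold (a k) in P.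
  rewrite Rabs_pos_eq in HN by (apply Rle_div_r; lra).
  apply Rlt_div_l in HN; [|lra].
  pose proof (Rmin_l eta 1); pose proof (Rmin_r eta 1); nra.
Qed.

Lemma Z1_limit (L : R) :
  is_lim_seq (fun n => Z1 F n x / INR n) L -> negligible a (fun k => Rabs (z k - L * a k)).
Proof.
intros H eta He; apply is_lim_seq_spec in H; destruct (H (mkposreal eta He)) as [N HN].
exists (S N); intros k Hk; pose proof (pos_ge k) as Hp.
specialize (HN (pos k) ltac:(lia)); simpl in HN.
rewrite (Z1_lder g F r K C) in HN by (auto; lra); fold (node k) (z k) (a k) in HN.
assert (Ha : 0 < a k) by (apply lt_0_INR; lia).
replace (z k - L * a k) with ((z k / a k - L) * a k) by (field; lra).
rewrite Rabs_mult, (Rabs_pos_eq (a k)) by lra; apply Rmult_le_compat_r; lra.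
Qed.

Lemma find_pos (N n : nat) : (pos N <= n)%nat ->
  exists k, (N <= k)%nat /\ (pos k <= n <= pos k + gap k)%nat.
Proof.
intros Hn.
assert (HM : (n < pos (N + S n))%nat) by (pose proof (pos_ge (N + S n)); lia).
induction (S n) as [|M IH]; [rewrite Nat.add_0_r in HM; lia|].
destruct (Nat.lt_ge_cases n (pos (N + M))) as [Hlt|Hle]; [apply IH, Hlt|].
exists (N + M)%nat; rewrite Nat.add_succ_r, pos_S in HM; lia.
Qed.

(** Between two nodes both Z and L n change by at most a multiple of the gap. *)
Lemma Z1_limit_nodes (L : R) : negligible a (fun k => INR (gap k)) ->
  negligible a (fun k => Rabs (z k - L * a k)) ->
  is_lim_seq (fun n => Z1 F n x / INR n) L.
Proof.
intros Hg Hz; apply is_lim_seq_spec; intros e; pose proof (cond_pos e) as He.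
pose proof (est_K g F r K C Hest) as HK; pose proof (Rabs_pos L) as HL.
assert (H : negligible a (fun k => Rabs (z k - L * a k) + (K + Rabs L + 1) * INR (gap k))).
{ apply negligible_plus; [exact Hz|apply negligible_scal; [lra|exact Hg]]. }
destruct (H (e / 2) ltac:(lra)) as [N HN].
exists (S (pos (S N))); intros n Hn.
destruct (find_pos (S N) n ltac:(lia)) as (k & Hk & Hkn).
specialize (HN k ltac:(lia)); cbv beta in HN.
pose (i := (n - pos k)%nat); assert (En : n = (pos k + i)%nat) by (unfold i; lia).
pose proof (Z1_node k i) as A; rewrite <- En in A.
assert (Hi : INR i <= INR (gap k)) by (apply le_INR; lia).
assert (Hn0 : 0 < INR n) by (apply lt_0_INR; lia).
assert (Ena : INR n = a k + INR i) by (rewrite En, plus_INR; reflexivity).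
replace (Z1 F n x / INR n - L) with ((Z1 F n x - L * INR n) / INR n) by (field; lra).
unfold Rdiv; rewrite Rabs_mult, Rabs_inv, (Rabs_pos_eq (INR n)) by lra.
apply Rlt_div_l; [exact Hn0|].
replace (Z1 F n x - L * INR n) with ((Z1 F n x - z k) + ((z k - L * a k) + - (L * INR i)))
  by (rewrite Ena; ring).
assert (B : Rabs (- (L * INR i)) <= Rabs L * INR (gap k)).
{ rewrite Rabs_Ropp, Rabs_mult, (Rabs_pos_eq (INR i)) by apply pos_INR.
  apply Rmult_le_compat_l; lra. }
pose proof (Rabs_add_bound _ _ _ _ A (Rabs_add_bound _ _ _ _ (Rle_refl (Rabs (z k - L * a k))) B)) as S.
pose proof (pos_INR i); pose proof (pos_INR (gap k)).
assert (K * INR i <= K * INR (gap k)) by (apply Rmult_le_compat_l; lra).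
assert (a k <= INR n) by lra.
nra.
Qed.

Let limit (L : R) : Prop :=
  filterlim (fun h => Delta1F F x (x + h) / log2 (1 / h)) (at_right 0) (locally L).

(** With l = log2(1/h), Delta - L l splits into Delta - z, z - L a and -L (l - a); the outer two are
    O(1 + gap) by [average_upper]. *)
Lemma limit_of_nodes (L : R) : negligible a (fun k => INR (gap k)) ->
  negligible a (fun k => Rabs (z k - L * a k)) -> limit L.
Proof.
intros Hg Hz; destruct average_upper as (C' & HC & Hup).
pose proof (Rabs_pos L) as HL.
assert (H : negligible a (fun k => Rabs (z k - L * a k)
  + ((C' + Rabs L) * INR (gap k) + (C' + 2 * Rabs L)))).
{ apply negligible_plus; [exact Hz|apply negligible_plus].
  - apply negligible_scal; [lra|exact Hg].
  - apply negligible_const, a_ge. }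
apply filterlim_locally; intros e; pose proof (cond_pos e) as He.
destruct (H (e / 2) ltac:(lra)) as [N HN].
assert (Hd : 0 < right (S N) - x).
{ pose proof (node_bounds (S N)); pose proof (width_pos (node (S N))).
  unfold right, mid in *; lra. }
exists (mkposreal _ Hd); intros h Hh Hh0.
assert (Hh' : h < right (S N) - x).
{ apply Rabs_lt_between in Hh; unfold minus, plus, opp in Hh; simpl in Hh; lra. }
destruct (find_node (S N) (x + h) ltac:(lra)) as (k & Hk & Hu).
destruct (Hup k (x + h) Hu) as [A B]; specialize (HN k ltac:(lia)); cbv beta in HN.
assert (Eh : x + h - x = h :> R) by ring; rewrite Eh in B.
set (D := Delta1F F x (x + h)) in *; set (l := log2 (1 / h)) in *.
assert (Ha : 1 <= a k) by (apply (le_INR 1); pose proof (pos_ge k); lia).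
pose proof (pos_INR (gap k)) as Hgp.
change (Rabs (D / l - L) < e).
replace (D / l - L) with ((D - L * l) / l) by (field; lra).
unfold Rdiv; rewrite Rabs_mult, Rabs_inv, (Rabs_pos_eq l) by lra.
apply Rlt_div_l; [lra|].
replace (D - L * l) with ((D - z k) + ((z k - L * a k) + - (L * (l - a k)))) by ring.
assert (X : Rabs (- (L * (l - a k))) <= Rabs L * (INR (gap k) + 2)).
{ rewrite Rabs_Ropp, Rabs_mult, (Rabs_pos_eq (l - a k)) by lra.
  apply Rmult_le_compat_l; lra. }
pose proof (Rabs_add_bound _ _ _ _ A (Rabs_add_bound _ _ _ _ (Rle_refl (Rabs (z k - L * a k))) X)) as S.
nra.
Qed.

Lemma limit_spec (L : R) : limit L -> forall eta, 0 < eta ->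
  exists N, forall k u, (N <= k)%nat -> x < u <= right k -> 0 < log2 (1 / (u - x)) ->
  Rabs (Delta1F F x u - L * log2 (1 / (u - x))) <= eta * log2 (1 / (u - x)).
Proof.
intros H eta He; pose proof (proj1 (filterlim_locally _ _) H (mkposreal eta He)) as [d Hd].
destruct (right_close d (cond_pos d)) as [N HN].
exists N; intros k u Hk Hu Hl; specialize (HN k Hk).
assert (Y : Rabs (Delta1F F x u / log2 (1 / (u - x)) - L) < eta).
{ assert (B : ball 0 d (u - x)).
  { change (Rabs (u - x - 0) < d); rewrite Rminus_0_r, Rabs_pos_eq; lra. }
  specialize (Hd (u - x) B ltac:(lra)).
  replace (x + (u - x)) with u in Hd by ring; exact Hd. }
set (l := log2 (1 / (u - x))) in *.
replace (Delta1F F x u - L * l) with ((Delta1F F x u / l - L) * l) by (field; lra).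
rewrite Rabs_mult, (Rabs_pos_eq l) by lra; apply Rmult_le_compat_r; lra.
Qed.

(** Test the limit at [right k], where both the quotient and the logarithm have bounded error
    regardless of the gap. *)
Lemma limit_nodes (L : R) : limit L -> negligible a (fun k => Rabs (z k - L * a k)).
Proof.
intros H; pose proof (Rabs_pos L).
assert (Main : forall eta, 0 < eta -> exists N, forall k, (N <= k)%nat ->
  Rabs (z k - L * a k) <= eta * a k + (eta + C / r + Rabs L)).
{ intros eta He; destruct (limit_spec L H eta He) as [N HN].
  exists (S N); intros k Hk; destruct (average_right k) as [A B].
  assert (Ha : 1 <= a k) by (apply (le_INR 1); pose proof (pos_ge k); lia).
  specialize (HN k (right k) ltac:(lia)).
  assert (Hxr : x < right k <= right k).
  { pose proof (node_bounds k); pose proof (width_pos (node k)).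
    unfold right, mid in *; lra. }
  specialize (HN Hxr ltac:(lra)).
  set (D := Delta1F F x (right k)) in *; set (l := log2 _) in *.
  replace (z k - L * a k) with (- (D - z k) + ((D - L * l) + L * (l - a k))) by ring.
  assert (X : Rabs (L * (l - a k)) <= Rabs L * 1).
  { rewrite Rabs_mult, (Rabs_pos_eq (l - a k)) by lra; apply Rmult_le_compat_l; lra. }
  rewrite <- Rabs_Ropp in A.
  pose proof (Rabs_add_bound _ _ _ _ A (Rabs_add_bound _ _ _ _ HN X)); nra. }
intros eta He; destruct (Main (eta / 2) ltac:(lra)) as [N HN].
destruct (negligible_const a (eta / 2 + C / r + Rabs L) a_ge (eta / 2) ltac:(lra)) as [N' HN'].
exists (max N N'); intros k Hk; specialize (HN k ltac:(lia)); specialize (HN' k ltac:(lia)).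
cbv beta in HN'; lra.
Qed.

(* If L < r eps, points slightly to the right of the midpoint give averages that
   grow by r eps per level while log2(1/h) only accounts for L; if L >= r eps > 0,
   the values z drop along the digits 1 instead of growing with slope L. *)
Lemma limit_gap (L : R) : limit L -> negligible a (fun k => INR (gap k)).
Proof.
intros H; pose proof (limit_nodes L H) as Hz; pose proof (Rabs_pos L) as HL.
destruct (est_r _ _ _ _ _ Hest) as [Hr _].
set (d := r * eps); assert (Hd : 0 < d) by (apply Rmult_lt_0_compat; lra).
destruct (Rlt_le_dec L d) as [Hlt|Hge].
- destruct average_lower as (b & C' & Hb & HC & Hlow); fold d in Hlow.
  (* Half of the excess slope d - L is kept as a multiple of j; the other half pays for the error
     eta j, as eta <= c. *)
  set (c := (d - L) / 2); assert (Hc : 0 < c) by (unfold c; lra).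
  assert (Main : forall eta, 0 < eta <= c -> exists N, forall k, (N <= k)%nat ->
    c * INR (gap k / b) <= eta * a k + (Rabs (z k - L * a k) + (C' + Rabs L + c))).
  { intros eta He; destruct (limit_spec L H eta ltac:(lra)) as [N HN].
    exists (S N); intros k Hk; set (j := (gap k / b)%nat).
    destruct (Hlow k j) as (u & Hu & HD & Hlog).
    { apply Nat.Div0.mul_div_le. }
    pose proof (pos_INR j) as Hj.
    assert (Ha : 1 <= a k) by (apply (le_INR 1); pose proof (pos_ge k); lia).
    specialize (HN k u ltac:(lia) Hu ltac:(lra)).
    set (D := Delta1F F x u) in *; set (l := log2 _) in *.
    apply Rabs_le_between in HN.
    pose proof (Rle_abs (- (z k - L * a k))) as X; rewrite Rabs_Ropp in X.
    assert (Y : L * (l - a k - INR j) <= Rabs L).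
    { eapply Rle_trans; [apply Rle_abs|].
      rewrite Rabs_mult, (Rabs_pos_eq (l - a k - INR j)) by lra; nra. }
    assert (W : eta * l <= eta * a k + c * INR j + c) by nra.
    assert (V : (d - L) * INR j = 2 * (c * INR j)) by (unfold c; field).
    nra. }
  assert (Hj : negligible a (fun k => c * INR (gap k / b))).
  { intros eta He.
    pose proof (negligible_plus _ _ _ Hz (negligible_const a (C' + Rabs L + c) a_ge)) as S.
    destruct (S (eta / 2) ltac:(lra)) as [N1 HN1]; cbv beta in HN1.
    assert (He' : 0 < Rmin (eta / 2) c <= c) by (split; [apply Rmin_glb_lt; lra|apply Rmin_r]).
    destruct (Main _ He') as [N2 HN2].
    exists (max N1 N2); intros k Hk; specialize (HN1 k ltac:(lia)); specialize (HN2 k ltac:(lia)).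
    pose proof (Rmin_l (eta / 2) c).
    assert (0 <= a k) by apply pos_INR; nra. }
  pose proof (le_INR _ _ Hb) as Hb'; simpl in Hb'.
  apply (negligible_le a _ (fun k => INR b / c * (c * INR (gap k / b)) + INR b) 0).
  + intros k _; pose proof (Nat.mul_succ_div_gt (gap k) b ltac:(lia)) as X.
    apply Nat.lt_le_incl, le_INR in X; rewrite mult_INR, S_INR in X.
    replace (INR b / c * (c * INR (gap k / b))) with (INR b * INR (gap k / b)) by (field; lra).
    lra.
  + apply negligible_plus; [|apply negligible_const, a_ge].
    apply negligible_scal; [apply Rdiv_lt_0_compat; lra|exact Hj].
- pose proof (est_K g F r K C Hest) as HK.
  (* At node k + 1 the value z is at least (L - eta) a, whose increment since node k is nonnegative
     because eta <= d <= L; [z_decrease] lets z drop by about d gap. *)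
  assert (Main : forall eta, 0 < eta <= d -> exists N, forall k, (N <= k)%nat ->
    d * INR (gap k) <= eta * a k + (Rabs (z k - L * a k) + (K + d))).
  { intros eta He; destruct (Hz eta ltac:(lra)) as [N HN].
    exists N; intros k Hk; specialize (HN (S k) ltac:(lia)); cbv beta in HN.
    pose proof (z_decrease k) as A; fold d in A.
    assert (Ea : a (S k) = a k + INR (gap k) + 1)
      by (unfold a; rewrite pos_S, !plus_INR; reflexivity).
    rewrite Ea in HN.
    pose proof (Rle_abs (z k - L * a k)) as X.
    pose proof (pos_INR (gap k)).
    apply Rabs_le_between in HN.
    nra. }
  assert (Hj : negligible a (fun k => d * INR (gap k))).
  { intros eta He.
    pose proof (negligible_plus _ _ _ Hz (negligible_const a (K + d) a_ge)) as S.
    destruct (S (eta / 2) ltac:(lra)) as [N1 HN1]; cbv beta in HN1.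
    assert (He' : 0 < Rmin (eta / 2) d <= d) by (split; [apply Rmin_glb_lt; lra|apply Rmin_r]).
    destruct (Main _ He') as [N2 HN2].
    exists (max N1 N2); intros k Hk; specialize (HN1 k ltac:(lia)); specialize (HN2 k ltac:(lia)).
    pose proof (Rmin_l (eta / 2) d).
    assert (0 <= a k) by apply pos_INR; nra. }
  apply (negligible_le a _ (fun k => / d * (d * INR (gap k))) 0).
  + intros k _; right; field; lra.
  + apply negligible_scal; [apply Rinv_0_lt_compat, Hd|exact Hj].
Qed.

Lemma limit_characterization :
  ((exists L, limit L) <->
   (is_lim_seq (fun n => INR (m (S n)) / INR (m n)) 1 /\
    exists L : R, is_lim_seq (fun n => Z1 F n x / INR n) L)) /\
  (is_lim_seq (fun n => INR (m (S n)) / INR (m n)) 1 ->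
   forall L : R, is_lim_seq (fun n => Z1 F n x / INR n) L -> limit L).
Proof.
assert (Back : is_lim_seq (fun n => INR (m (S n)) / INR (m n)) 1 ->
   forall L : R, is_lim_seq (fun n => Z1 F n x / INR n) L -> limit L).
{ intros H L HL; apply limit_of_nodes; [apply gap_ratio, H|apply Z1_limit, HL]. }
split; [split|exact Back].
- intros [L H]; split; [apply gap_ratio, (limit_gap L H)|].
  exists L; apply Z1_limit_nodes; [apply (limit_gap L H)|apply limit_nodes, H].
- intros [H [L HL]]; exists L; apply Back; assumption.
Qed.

End Asymptotics.

Lemma locally_open_itv (p q : Rbar) (t : R) : open_itv p q t -> locally t (open_itv p q).
Proof.
intros [Hp Hq]; apply filter_and.
- apply (open_Rbar_gt p t Hp).
- apply (open_Rbar_lt q t Hq).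
Qed.

Theorem theorem7p3 :
  forall (p q : Rbar) (g : curve) (F : R -> R -> R),
    open_itv p q 0 ->
    smooth_curve_in_E (open_itv p q) g ->
    (forall t, open_itv p q t -> de_Rham_solution g t (F t)) ->
    ND g ->
    forall x : R, 0 < x < 1 -> ~ dyadic x ->
    forall m : nat -> nat, enumerates_ones (1 - x) m ->
    ((exists L : R,
        filterlim (fun h => Delta1F F x (x + h) / log2 (1 / h))
                  (at_right 0) (locally L))
     <->
     (is_lim_seq (fun n => INR (m (S n)) / INR (m n)) 1 /\
      exists L : R, is_lim_seq (fun n => Z1 F n x / INR n) L))
    /\
    (is_lim_seq (fun n => INR (m (S n)) / INR (m n)) 1 ->
     forall L : R, is_lim_seq (fun n => Z1 F n x / INR n) L ->
       filterlim (fun h => Delta1F F x (x + h) / log2 (1 / h))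
                 (at_right 0) (locally L)).
Proof.
intros p q g F H0 (Sb & S0 & S1 & HE) HF HND x Hx Hdy m Hm.
pose proof (locally_open_itv p q 0 H0) as Hloc.
assert (Hreg : locally 0 (regular g)).
{ revert Hloc; apply filter_imp; intros t Ht; split.
  - destruct (HE t Ht) as (A & B & D & _); repeat split; tauto.
  - split; [apply (Sb 1%nat t Ht)|split; [apply (S0 1%nat t Ht)|apply (S1 1%nat t Ht)]]. }
(* The second derivative at 0 exists, hence the first derivative is continuous there. *)
assert (HD : forall f, smooth_on (open_itv p q) f -> continuous (Derive f) 0).
{ intros f Hf; apply (ex_derive_continuous (Derive f)); apply (Hf 2%nat 0 H0). }
destruct (estimates_exist g F Hreg (HD _ Sb) (HD _ S0) (HD _ S1)) as (r & K & C & Hest).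
{ revert Hloc; apply filter_imp; exact HF. }
destruct (ND_kap g (locally_singleton _ _ Hreg) HND) as (e & He & Hk).
exact (limit_characterization g F r K C e x m Hest He Hk Hx Hdy Hm).
Qed.
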